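(* Let $A=T(V)\otimes kG\otimes T(V^* )$ be a Hopf algebra with (free) triangular decomposition of weakly separable type over a group $G$, and let $n=\dim V$. For $A$ to be indecomposable as a coalgebra it is necessary that $G$ is generated by elements $k_1,\dots,k_n,l_1,\dots,l_n$ such that there exist generators $v_1,\dots,v_n$ of $V$ and $f_1,\dots,f_n$ of $V^*$ which are skew-primitive of the form $$\Delta(v_i)=v_i\otimes k_i+1\otimes v_i,\qquad \Delta(f_i)=f_i\otimes1+l_i\otimes f_i,$$ with $[k_i,l_j]=1$ (that is, $k_il_j=l_jk_i$) for all $i,j$. For the characters $\lambda_i$, $\mu_j$ of the actions on the homogeneous components of $V$ and $V^*$ it is required that $$\mu_j(k_i)=\lambda_i(l_j)^{-1}\qquad\text{for all } i,j.$$
   Context: Let $k$ be a field, $G$ a group (not assumed finite), $H=kG$. **Free braided doubles.** Let $V$ be a finite-dimensional left $H$-module and $V^*$ its dual with right action $\langle f\triangleleft h,v\rangle=\langle f,h\triangleright v\rangle$. For linear $\beta:V^*\otimes V\to H$, $A_\beta(V,V^* )$ is the algebra generated by $V,H,V^*$ with relations $fh=h_{(1)}(f\triangleleft h_{(2)})$, $hv=(h_{(1)}\triangleright v)h_{(2)}$, $fv-vf=\beta(f\otimes v)$; it is a free braided double, written $T(V)\otimes H\otimes T(V^* )$, if multiplication $T(V)\otimes H\otimes T(V^* )\to A_\beta(V,V^* )$ is a linear isomorphism. Natural grading: $\deg v=1$, $\deg h=0$, $\deg f=-1$. **Triangular decomposition.** A bialgebra with (free) triangular decomposition over $H$ is a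 free braided double $A$ with a bialgebra structure such that $H$ is a subcoalgebra with its original coproduct, $T(V)\otimes H$ and $H\otimes T(V^* )$ are closed under the coproduct, and coproduct and counit are graded algebra morphisms; it is a Hopf algebra with triangular decomposition if it has an antipode preserving the natural grading and these two subspaces. These axioms, with the counit property, give $\Delta(V)\subseteq V\otimes H+H\otimes V$ and $\Delta(V^* )\subseteq V^*\otimes H+H\otimes V^*$. Composing $\Delta$ with the projections gives a right coaction $V\to V\otimes H$ and a left coaction $V\to H\otimes V$ (and likewise for $V^*$), i.e. right and left $G$-gradings. **Weakly separable type.** The right degrees of a homogeneous basis of $V$ are pairwise distinct elements of $G$, and the same holds for the left degrees of $V$, and for the right and the left degrees of $V^*$. In this case the homogeneous components are one-dimensional and $g\in G$ maps a homogeneous basis element $v_i$ to a scalar multiple of a basis element: $g\triangleright v_i=\lambda_i(g)v_{g(i)}$, and similarly $f_i\triangleleft g=\mu_i(g)f_{g(i)}$, where $i\mapsto g(i)$ is an action of $G$ on $\{1,\dots,n\}$. The functions $\lambda_i,\mu_i$ on $G$ are called the characters of the actions on the homogeneous components. **Indecomposable.** $A$ is then pointed with grouplike elements $G$. Let $\Gamma_A$ be the graph with vertices the grouplike elements and an edge $h\to g$ if there is $x\in A$, $x\notin kG$, with $\Delta(x)=x\otimes g+h\otimes x$. $A$ is indecomposable as a coalgebra if and only if $\Gamma_A$ is connected.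
   Formalization: The skew-primitive generators are v_i = w_i a_i and f_i = u_i b_i with w, u bases of V, V* and a_i, b_i in G, not elements of V and V* themselves: for n ≥ 2 distinct left degrees rule out all v_i in V having left degree 1, and n = 1 has counterexamples. *)

(* Defs.v *)
From HB Require Import structures.
From mathcomp Require Import all_boot all_order all_algebra.
From mathcomp Require Import boolp.

Set Implicit Arguments.
Unset Strict Implicit.
Unset Printing Implicit Defensive.

Import GRing.Theory.
Local Open Scope ring_scope.
Local Open Scope quotient_scope.

(* The vector space generated by X, universal for the maps f : X -> W that
   satisfy P: formal linear combinations of elements of X, two of which are
   identified when every f satisfying P gives them the same value. The free
   vector space, tensor products and tensor powers are the instances below. *)
Section UniversalSpace.
Variables (K : fieldType) (X : choiceType).
Variable P : forall W : lmodType K, (X -> W) -> Prop.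

Definition feval (W : lmodType K) (f : X -> W) (s : seq (K * X)) : W :=
  \sum_(p <- s) p.1 *: f p.2.

Definition feqv (s t : seq (K * X)) : bool :=
  `[< forall (W : lmodType K) (f : X -> W), P f -> feval f s = feval f t >].

Lemma feqv_refl : reflexive feqv.
Proof. by move=> s; apply/asboolP. Qed.

Lemma feqv_sym : symmetric feqv.
Proof.
by move=> s t; apply/asboolP/asboolP => h W f Pf; rewrite (h W f Pf).
Qed.

Lemma feqv_trans : transitive feqv.
Proof.
move=> t s u /asboolP h1 /asboolP h2; apply/asboolP => W f Pf.
by rewrite (h1 W f Pf) (h2 W f Pf).
Qed.

Canonical feqv_equiv := EquivRel feqv feqv_refl feqv_sym feqv_trans.

Definition uspace := {eq_quot feqv_equiv}.
HB.instance Definition _ := Choice.on uspace.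

Definition uclass (s : seq (K * X)) : uspace := \pi s.
Definition ugen (x : X) : uspace := uclass [:: (1, x)].

(* Linear, with ulift f (ugen x) = f x, when P f holds; meaningless otherwise *)
Definition ulift (W : lmodType K) (f : X -> W) (a : uspace) : W :=
  feval f (repr a).

Lemma ulift_class (W : lmodType K) (f : X -> W) s :
  P f -> ulift f (uclass s) = feval f s.
Proof.
move=> Pf; have /eqmodP/asboolP h : repr (uclass s) = s %[mod uspace].
  by rewrite reprK.
exact: h.
Qed.

Lemma uspace_ext (a b : uspace) :
  (forall (W : lmodType K) (f : X -> W), P f -> ulift f a = ulift f b) -> a = b.
Proof.
move=> h; rewrite -[a]reprK -[b]reprK.
by apply/eqmodP/asboolP => W f Pf; exact: h.
Qed.

Lemma feval_cat (W : lmodType K) (f : X -> W) s t :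
  feval f (s ++ t) = feval f s + feval f t.
Proof. exact: big_cat. Qed.

Definition fscale (c : K) (s : seq (K * X)) := [seq (c * p.1, p.2) | p <- s].

Lemma feval_scale (W : lmodType K) (f : X -> W) c s :
  feval f (fscale c s) = c *: feval f s.
Proof.
by rewrite /feval big_map scaler_sumr; apply: eq_bigr => p _; rewrite scalerA.
Qed.

Definition uzero : uspace := uclass [::].
Definition uadd (a b : uspace) : uspace := uclass (repr a ++ repr b).
Definition uscale (c : K) (a : uspace) : uspace := uclass (fscale c (repr a)).
Definition uopp (a : uspace) : uspace := uscale (-1) a.

Lemma ulift0_subproof (W : lmodType K) (f : X -> W) : P f -> ulift f uzero = 0.
Proof. by move=> Pf; rewrite ulift_class // /feval big_nil. Qed.

Lemma uliftD_subproof (W : lmodType K) (f : X -> W) a b :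
  P f -> ulift f (uadd a b) = ulift f a + ulift f b.
Proof. by move=> Pf; rewrite ulift_class // feval_cat. Qed.

Lemma uliftZ_subproof (W : lmodType K) (f : X -> W) c a :
  P f -> ulift f (uscale c a) = c *: ulift f a.
Proof. by move=> Pf; rewrite ulift_class // feval_scale. Qed.

Let uE := (ulift0_subproof, uliftD_subproof, uliftZ_subproof).

Lemma uaddA : associative uadd.
Proof. by move=> a b c; apply: uspace_ext => W f Pf; rewrite !uE // addrA. Qed.
Lemma uaddC : commutative uadd.
Proof. by move=> a b; apply: uspace_ext => W f Pf; rewrite !uE // addrC. Qed.
Lemma uadd0 : left_id uzero uadd.
Proof. by move=> a; apply: uspace_ext => W f Pf; rewrite !uE // add0r. Qed.
Lemma uaddN : left_inverse uzero uopp uadd.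
Proof.
by move=> a; apply: uspace_ext => W f Pf; rewrite !uE // scaleN1r addNr.
Qed.
HB.instance Definition _ := GRing.isZmodule.Build uspace uaddA uaddC uadd0 uaddN.

Lemma uscaleA c d a : uscale c (uscale d a) = uscale (c * d) a.
Proof. by apply: uspace_ext => W f Pf; rewrite !uE // scalerA. Qed.
Lemma uscale1 : left_id 1 uscale.
Proof. by move=> a; apply: uspace_ext => W f Pf; rewrite !uE // scale1r. Qed.
Lemma uscaleDr : right_distributive uscale +%R.
Proof.
by move=> c a b; apply: uspace_ext => W f Pf; rewrite /GRing.add /= !uE // scalerDr.
Qed.
Lemma uscaleDl a : {morph uscale^~ a : c d / c + d}.
Proof.
move=> c d; apply: uspace_ext => W f Pf.
by rewrite [in RHS]/GRing.add /= !uE // scalerDl.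
Qed.
HB.instance Definition _ :=
  GRing.Zmodule_isLmodule.Build K uspace uscaleA uscale1 uscaleDr uscaleDl.

Lemma ulift_linear (W : lmodType K) (f : X -> W) : P f -> linear (ulift f).
Proof.
by move=> Pf c a b; rewrite [in LHS]/GRing.add /= !uE.
Qed.

Lemma ulift_gen (W : lmodType K) (f : X -> W) x : P f -> ulift f (ugen x) = f x.
Proof. by move=> Pf; rewrite ulift_class // /feval big_seq1 scale1r. Qed.

Lemma uclassE s : uclass s = \sum_(p <- s) p.1 *: ugen p.2.
Proof.
apply: uspace_ext => W f Pf; rewrite ulift_class //.
elim: s => [|p s ih]; first by rewrite big_nil /feval big_nil [RHS]uE.
rewrite big_cons addrC [RHS](uliftD_subproof _ _ Pf) -ih.
by rewrite [X in _ + X]uliftZ_subproof // ulift_gen // addrC /feval big_cons.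
Qed.

Lemma uspaceE (a : uspace) : a = \sum_(p <- repr a) p.1 *: ugen p.2.
Proof. by rewrite -uclassE /uclass reprK. Qed.

Lemma uspace_ind (Q : uspace -> Prop) :
  (forall x, Q (ugen x)) -> (forall c a b, Q a -> Q b -> Q (c *: a + b)) ->
  Q 0 -> forall a, Q a.
Proof.
move=> Qg Ql Q0 a; rewrite (uspaceE a).
elim: (repr a) => [|p s ih]; first by rewrite big_nil.
by rewrite big_cons; apply: Ql.
Qed.

Lemma uspace_linear_ext (W : lmodType K) (f g : uspace -> W) :
  linear f -> linear g -> (forall x, f (ugen x) = g (ugen x)) -> f =1 g.
Proof.
move=> lf lg h; apply: uspace_ind => [x //|c a b ha hb|].
  by rewrite lf lg ha hb.
have lin0 (u : uspace -> W) : linear u -> u 0 = 0.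
  by move=> lu; have := lu (-1) 0 0; rewrite scaler0 addr0 scaleN1r addNr.
by rewrite !lin0.
Qed.

End UniversalSpace.

Section GroupAlgebra.
Variables (K : fieldType) (G : groupType).

Definition galg := @uspace K G (fun _ _ => True).
HB.instance Definition _ := GRing.Lmodule.on galg.

Definition ggen (g : G) : galg := ugen _ g.
Definition glift (W : lmodType K) (f : G -> W) : galg -> W := ulift f.

Lemma glift_linear (W : lmodType K) (f : G -> W) : linear (glift f).
Proof. exact: ulift_linear. Qed.
HB.instance Definition _ (W : lmodType K) (f : G -> W) :=
  GRing.isLinear.Build K galg W _ (glift f) (glift_linear f).

Lemma gliftE (W : lmodType K) (f : G -> W) g : glift f (ggen g) = f g.
Proof. exact: ulift_gen. Qed.

Lemma galg_ind (Q : galg -> Prop) :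
  (forall g, Q (ggen g)) -> (forall c a b, Q a -> Q b -> Q (c *: a + b)) ->
  Q 0 -> forall a, Q a.
Proof. exact: uspace_ind. Qed.

Definition gmul (a b : galg) : galg :=
  glift (fun g => glift (fun h => ggen (g * h)%g) b) a.
Definition gone : galg := ggen 1%g.

Lemma gmulPl c a a' b : gmul (c *: a + a') b = c *: gmul a b + gmul a' b.
Proof. exact: linearP. Qed.
Lemma gmulPr c a b b' : gmul a (c *: b + b') = c *: gmul a b + gmul a b'.
Proof.
elim/galg_ind: a => [g|d a a' ha ha'|].
- by rewrite /gmul !gliftE linearP.
- by rewrite !gmulPl ha ha' !scalerDr !scalerA (mulrC d) addrACA.
- by rewrite /gmul !linear0 ?scaler0 ?addr0.
Qed.
Lemma gmul0l b : gmul 0 b = 0. Proof. exact: linear0. Qed.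
Lemma gmul0r a : gmul a 0 = 0.
Proof.
have := gmulPr (-1) a 0 0; rewrite scaler0 addr0 => h.
by rewrite h scaleN1r addNr.
Qed.
Lemma gmul_gen g h : gmul (ggen g) (ggen h) = ggen (g * h)%g.
Proof. by rewrite /gmul !gliftE. Qed.

Lemma gmulA : associative gmul.
Proof.
move=> a b c; elim/galg_ind: a => [g|d a a' ha ha'|].
- elim/galg_ind: b => [h|d b b' hb hb'|].
  + elim/galg_ind: c => [i|d c c' hc hc'|].
    * by rewrite !gmul_gen mulgA.
    * by rewrite !gmulPr hc hc'.
    * by rewrite !gmul0r.
  + by rewrite gmulPl !gmulPr gmulPl hb hb'.
  + by rewrite gmul0l gmul0r gmul0l.
- by rewrite !gmulPl ha ha'.
- by rewrite !gmul0l.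
Qed.
Lemma gmul1l : left_id gone gmul.
Proof.
elim/galg_ind => [g|c a b ha hb|]; first by rewrite gmul_gen mul1g.
  by rewrite gmulPr ha hb.
by rewrite gmul0r.
Qed.
Lemma gmul1r : right_id gone gmul.
Proof.
elim/galg_ind => [g|c a b ha hb|]; first by rewrite gmul_gen mulg1.
  by rewrite gmulPl ha hb.
by rewrite gmul0l.
Qed.
Lemma gmulDl : left_distributive gmul +%R.
Proof. by move=> a b c; have := gmulPl 1 a b c; rewrite !scale1r. Qed.
Lemma gmulDr : right_distributive gmul +%R.
Proof. by move=> a b c; have := gmulPr 1 a b c; rewrite !scale1r. Qed.
Lemma gone_neq0 : gone != 0.
Proof.
apply/eqP => /(congr1 (glift (fun _ => 1 : K^o))).
by rewrite gliftE linear0 => /eqP; rewrite oner_eq0.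
Qed.
HB.instance Definition _ := GRing.Zmodule_isNzRing.Build galg
  gmulA gmul1l gmul1r gmulDl gmulDr gone_neq0.

Lemma gscaleAl (c : K) (a b : galg) : c *: (a * b) = (c *: a) * b.
Proof. by have := gmulPl c a 0 b; rewrite gmul0l !addr0. Qed.
HB.instance Definition _ := GRing.Lmodule_isLalgebra.Build K galg gscaleAl.
Lemma gscaleAr (c : K) (a b : galg) : c *: (a * b) = a * (c *: b).
Proof. by have := gmulPr c a b 0; rewrite gmul0r !addr0. Qed.
HB.instance Definition _ := GRing.Lalgebra_isAlgebra.Build K galg gscaleAr.

End GroupAlgebra.

Definition bilin (K : fieldType) (U V W : lmodType K) (b : U -> V -> W) : Prop :=
  (forall v, linear (b^~ v)) /\ (forall u, linear (b u)).

Section Tensor.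
Variables (K : fieldType) (U V : lmodType K).

Definition tens := @uspace K (U * V)%type
  (fun W f => bilin (fun (u : U) (v : V) => f (u, v))).
HB.instance Definition _ := GRing.Lmodule.on tens.

Definition tpure (u : U) (v : V) : tens := ugen _ (u, v).
Local Notation "u ⊗ v" := (tpure u v) (at level 45, left associativity).

(* Linear, with tlift b (u ⊗ v) = b u v, when b is bilinear;
   meaningless otherwise *)
Definition tlift (W : lmodType K) (b : U -> V -> W) : tens -> W :=
  ulift (fun p => b p.1 p.2).

Lemma tlift_linear (W : lmodType K) (b : U -> V -> W) :
  bilin b -> linear (tlift b).
Proof. by move=> hb; apply: ulift_linear. Qed.

Lemma tliftE (W : lmodType K) (b : U -> V -> W) u v :
  bilin b -> tlift b (u ⊗ v) = b u v.
Proof. by move=> hb; rewrite /tlift ulift_gen. Qed.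

Lemma tens_ext (x y : tens) :
  (forall (W : lmodType K) (b : U -> V -> W), bilin b -> tlift b x = tlift b y) ->
  x = y.
Proof.
move=> h; apply: uspace_ext => W f Pf.
have e : (fun p : U * V => f (p.1, p.2)) = f by apply/funext => -[].
by have := h W (fun u v => f (u, v)) Pf; rewrite /tlift /= e.
Qed.

Lemma tpure_bilin : bilin tpure.
Proof.
split=> [v c u u'|u c v v']; apply: tens_ext => W b hb;
  by rewrite tlift_linear // !tliftE //; case: hb => hl hr; rewrite ?hl ?hr.
Qed.

Lemma tens_ind (Q : tens -> Prop) :
  (forall u v, Q (u ⊗ v)) -> (forall c x y, Q x -> Q y -> Q (c *: x + y)) ->
  Q 0 -> forall x, Q x.
Proof. by move=> Qp; apply: uspace_ind => -[]. Qed.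

End Tensor.

Notation "u ⊗ v" := (tpure u v) (at level 45, left associativity) : ring_scope.

Section TensorMap.
Variables (K : fieldType).

Definition tmap (U V U' V' : lmodType K) (f : U -> U') (g : V -> V') :
  tens U V -> tens U' V' := tlift (fun u v => f u ⊗ g v).

Definition tassoc (U V W : lmodType K) :
  tens (tens U V) W -> tens U (tens V W) :=
  tlift (fun x w => tlift (fun u v => u ⊗ (v ⊗ w)) x).

Lemma tmap_bilin (U V U' V' : lmodType K) (f : U -> U') (g : V -> V') :
  linear f -> linear g -> bilin (fun u v => f u ⊗ g v).
Proof.
move=> lf lg; have [pl pr] := @tpure_bilin K U' V'.
by split=> [v c u u'|u c v v']; [rewrite lf pl | rewrite lg pr].
Qed.

Lemma bilin_tlift (U V W Z : lmodType K) (b : U -> V -> Z -> W) :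
  (forall z, bilin (fun u v => b u v z)) -> (forall u v, linear (b u v)) ->
  bilin (fun x z => tlift (fun u v => b u v z) x).
Proof.
move=> hb hl; split=> [z|x c z z']; first exact: tlift_linear.
elim/tens_ind: x => [u v|d x y hx hy|].
- by rewrite !tliftE // hl.
- by rewrite !tlift_linear // hx hy !scalerDr !scalerA (mulrC d) addrACA.
- have l0 z0 : tlift (fun u v => b u v z0) 0 = 0.
    have := tlift_linear (hb z0) (-1) 0 0.
    by rewrite scaler0 addr0 scaleN1r addNr.
  by rewrite !l0 scaler0 addr0.
Qed.

Lemma tmapE (U V U' V' : lmodType K) (f : U -> U') (g : V -> V') u v :
  linear f -> linear g -> tmap f g (u ⊗ v) = f u ⊗ g v.
Proof. by move=> lf lg; rewrite /tmap tliftE //; apply: tmap_bilin. Qed.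

Lemma tassocE (U V W : lmodType K) (u : U) (v : V) (w : W) :
  tassoc (u ⊗ v ⊗ w) = u ⊗ (v ⊗ w).
Proof.
have b3 (z : W) : bilin (fun (u0 : U) (v0 : V) => u0 ⊗ (v0 ⊗ z)).
  have [pl _] := @tpure_bilin K V W.
  by apply: (@tmap_bilin U V U (tens V W) id (fun v0 => v0 ⊗ z)); last exact: pl.
rewrite /tassoc tliftE ?tliftE //.
apply: bilin_tlift => // u0 v0 c z z'.
by rewrite (tpure_bilin _ _).2 (tpure_bilin _ _).2.
Qed.

End TensorMap.

(* (a ⊗ b) (c ⊗ d) = a c ⊗ b d *)
Section TensorAlgebraProduct.
Variables (K : fieldType) (A B : algType K).

Definition tmul (x y : tens A B) : tens A B :=
  tlift (fun a b => tmap ( *%R a) ( *%R b) y) x.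
Definition tone : tens A B := 1 ⊗ 1.

Let lmulr (C : algType K) (a : C) : linear ( *%R a).
Proof. by move=> c x y; rewrite mulrDr -scalerAr. Qed.

Let tmap_lin (a : A) (b : B) : linear (tmap ( *%R a) ( *%R b)).
Proof. by apply: tlift_linear; apply: tmap_bilin; [exact: (lmulr a) | exact: (lmulr b)]. Qed.

Let tmul_bilin (y : tens A B) :
  bilin (fun (a : A) (b : B) => tmap ( *%R a) ( *%R b) y).
Proof.
have lin0 (W Z : lmodType K) (f : W -> Z) : linear f -> f 0 = 0.
  by move=> /(_ (-1) 0 0); rewrite scaler0 addr0 scaleN1r addNr.
elim/tens_ind: y => [c d|e x y hx hy|].
- have [pl pr] := @tpure_bilin K A B.
  by split=> [b k a a'|a k b b'];
    rewrite !tmapE ?mulrDl -?scalerAl ?pl ?pr //; exact: lmulr.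
- case: hx hy => hxl hxr [hyl hyr].
  by split=> [b k a a'|a k b b']; rewrite !tmap_lin ?hxl ?hyl ?hxr ?hyr
    !scalerDr !scalerA (mulrC k) addrACA.
- split=> [b k a a'|a k b b'];
  by rewrite !(lin0 _ _ _ (tmap_lin _ _)) scaler0 addr0.
Qed.

Lemma tmulPl c x x' y : tmul (c *: x + x') y = c *: tmul x y + tmul x' y.
Proof. exact: tlift_linear. Qed.
Lemma tmul0l y : tmul 0 y = 0.
Proof. by have := tmulPl (-1) 0 0 y; rewrite scaler0 addr0 scaleN1r addNr. Qed.
Lemma tmulE a b c d : tmul (a ⊗ b) (c ⊗ d) = (a * c) ⊗ (b * d).
Proof.
rewrite /tmul tliftE ?tmapE //; [exact: (lmulr a) | exact: (lmulr b)].
Qed.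
Lemma tmulPr c x y y' : tmul x (c *: y + y') = c *: tmul x y + tmul x y'.
Proof.
elim/tens_ind: x => [a b|d x x' hx hx'|].
- by rewrite /tmul !tliftE // tmap_lin.
- by rewrite !tmulPl hx hx' !scalerDr !scalerA (mulrC d) addrACA.
- by rewrite !tmul0l scaler0 addr0.
Qed.
Lemma tmul0r x : tmul x 0 = 0.
Proof. by have := tmulPr (-1) x 0 0; rewrite scaler0 addr0 scaleN1r addNr. Qed.

Lemma tmulA : associative tmul.
Proof.
move=> x y z; elim/tens_ind: x => [a b|k x x' hx hx'|].
- elim/tens_ind: y => [c d|k y y' hy hy'|].
  + elim/tens_ind: z => [e f|k z z' hz hz'|].
    * by rewrite !tmulE !mulrA.
    * by rewrite !tmulPr hz hz'.
    * by rewrite !tmul0r.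
  + by rewrite tmulPl !tmulPr tmulPl hy hy'.
  + by rewrite tmul0l tmul0r tmul0l.
- by rewrite !tmulPl hx hx'.
- by rewrite !tmul0l.
Qed.
Lemma tmul1l : left_id tone tmul.
Proof.
elim/tens_ind => [a b|k x y hx hy|]; first by rewrite tmulE !mul1r.
  by rewrite tmulPr hx hy.
by rewrite tmul0r.
Qed.
Lemma tmul1r : right_id tone tmul.
Proof.
elim/tens_ind => [a b|k x y hx hy|]; first by rewrite tmulE !mulr1.
  by rewrite tmulPl hx hy.
by rewrite tmul0l.
Qed.
Lemma tmulDl : left_distributive tmul +%R.
Proof. by move=> x y z; have := tmulPl 1 x y z; rewrite !scale1r. Qed.
Lemma tmulDr : right_distributive tmul +%R.
Proof. by move=> x y z; have := tmulPr 1 x y z; rewrite !scale1r. Qed.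
HB.instance Definition _ := GRing.Zmodule_isPzRing.Build (tens A B)
  tmulA tmul1l tmul1r tmulDl tmulDr.

End TensorAlgebraProduct.

(* T(V): words in V modulo multilinearity. Only the underlying space is needed;
   the empty word is the unit and the product is concatenation. *)
Section TensorAlgebra.
Variables (K : fieldType) (V : lmodType K).

Definition talg := @uspace K (seq V)
  (fun W f => forall s1 s2 : seq V, linear (fun v => f (s1 ++ v :: s2))).
HB.instance Definition _ := GRing.Lmodule.on talg.

Definition tword (s : seq V) : talg := ugen _ s.

(* The algebra morphism T(V) -> B extending a linear map j : V -> B *)
Definition talg_lift (B : algType K) (j : V -> B) : talg -> B :=
  ulift (fun s => \prod_(v <- s) j v).

Lemma talg_liftP (B : algType K) (j : V -> B) : linear j ->
  forall s1 s2 : seq V, linear (fun v => \prod_(u <- s1 ++ v :: s2) j u).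
Proof.
move=> lj s1 s2 c v v'; rewrite !big_cat !big_cons /= lj.
by rewrite mulrDl -scalerAl mulrDr -scalerAr.
Qed.

Lemma talg_liftE (B : algType K) (j : V -> B) s : linear j ->
  talg_lift j (tword s) = \prod_(v <- s) j v.
Proof. by move=> lj; rewrite /talg_lift ulift_gen //; apply: talg_liftP. Qed.

End TensorAlgebra.

Notation dual K V := 'Hom(V, K^o).

Section FreeBraidedDoubles.
Variables (K : fieldType) (G : groupType).
Local Notation H := (galg K G).

Definition gdelta : H -> tens H H := glift (fun g => ggen K g ⊗ ggen K g).

Definition left_module (V : lmodType K) (act : H -> V -> V) : Prop :=
  [/\ bilin act, forall v, act 1 v = v
    & forall a b v, act (a * b) v = act a (act b v)].

Record braided_datum := BraidedDatum {
  bdV : vectType K;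
  bdact : H -> bdV -> bdV;
  bdactP : left_module bdact;
  bdbeta : {linear tens (dual K bdV) bdV -> H}
}.

(* <f <| h, v> = <f, h |> v> *)
Definition ract (D : braided_datum) (f : dual K (bdV D)) (h : H) :
  dual K (bdV D) := linfun (fun v => f (bdact h v)).

(* Linear maps from V, H, V^* to an algebra B that satisfy the relations of
   A_beta(V, V^* ). In the first two relations tlift evaluates the Sweedler
   expression in h_(1), h_(2) at the coproduct of h. *)
Record double_map (D : braided_datum) (B : algType K) := DoubleMap {
  jV : {linear bdV D -> B};
  jH : {lrmorphism H -> B};
  jF : {linear dual K (bdV D) -> B};
  rel_FH : forall f h,
    jF f * jH h = tlift (fun h1 h2 => jH h1 * jF (ract f h2)) (gdelta h);
  rel_HV : forall h v,
    jH h * jV v = tlift (fun h1 h2 => jV (bdact h1 v) * jH h2) (gdelta h);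
  rel_FV : forall f v, jF f * jV v - jV v * jF f = jH (bdbeta D (f ⊗ v))
}.

Definition intertwines (D : braided_datum) (A B : algType K)
    (i : double_map D A) (j : double_map D B) (phi : A -> B) : Prop :=
  [/\ forall v, phi (jV i v) = jV j v, forall h, phi (jH i h) = jH j h
    & forall f, phi (jF i f) = jF j f].

(* A, with the maps i, is the algebra A_beta(V, V^* ) presented by V, H, V^*
   and the three relations *)
Definition is_Abeta (D : braided_datum) (A : algType K) (i : double_map D A) :
    Prop :=
  forall (B : algType K) (j : double_map D B),
    exists phi : {lrmorphism A -> B}, intertwines i j phi /\
      forall psi : {lrmorphism A -> B}, intertwines i j psi -> phi =1 psi.

Section Maps.
Variables (D : braided_datum) (A : algType K) (i : double_map D A).
Local Notation TV := (talg (bdV D)).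
Local Notation TF := (talg (dual K (bdV D))).

Definition mult_VH : tens TV H -> A :=
  tlift (fun t h => talg_lift (jV i) t * jH i h).
Definition mult_HF : tens H TF -> A :=
  tlift (fun h s => jH i h * talg_lift (jF i) s).
Definition mult_VHF : tens (tens TV H) TF -> A :=
  tlift (fun x s => mult_VH x * talg_lift (jF i) s).

Definition free_braided_double : Prop := is_Abeta i /\ bijective mult_VHF.

(* The subspaces T(V) H and H T(V^* ) of A *)
Definition sub_VH (a : A) : Prop := exists x, mult_VH x = a.
Definition sub_HF (a : A) : Prop := exists x, mult_HF x = a.

(* natdeg m is the homogeneous component of degree m *)
Inductive natdeg : int -> A -> Prop :=
| natdeg_V v : natdeg 1 (jV i v)
| natdeg_H h : natdeg 0 (jH i h)
| natdeg_F f : natdeg (-1) (jF i f)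
| natdeg_0 m : natdeg m 0
| natdeg_lin m c a b : natdeg m a -> natdeg m b -> natdeg m (c *: a + b)
| natdeg_mul m n a b : natdeg m a -> natdeg n b -> natdeg (m + n) (a * b).

Definition tens_natdeg (m : int) (x : tens A A) : Prop :=
  exists s : seq (A * A), x = \sum_(p <- s) (p.1 ⊗ p.2) /\
    forall p, p \in s ->
      exists m1 m2, [/\ natdeg m1 p.1, natdeg m2 p.2 & m1 + m2 = m].

End Maps.

(* C ⊗ D inside A ⊗ A *)
Definition tens_sub (A : lmodType K) (C D : A -> Prop) (x : tens A A) : Prop :=
  exists s : seq (A * A), x = \sum_(p <- s) (p.1 ⊗ p.2) /\
    forall p, p \in s -> C p.1 /\ D p.2.

Definition is_coalgebra (A : lmodType K) (delta : A -> tens A A)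
    (eps : A -> K) : Prop :=
  [/\ forall a, tassoc (tmap delta id (delta a)) = tmap id delta (delta a),
      forall a, tlift (fun x y => eps x *: y) (delta a) = a
    & forall a, tlift (fun x y => eps y *: x) (delta a) = a].

Definition is_bialgebra (A : algType K) (delta : {linear A -> tens A A})
    (eps : {linear A -> K^o}) : Prop :=
  [/\ is_coalgebra delta eps, monoid_morphism delta & monoid_morphism eps].

Definition is_antipode (A : algType K) (delta : {linear A -> tens A A})
    (eps : {linear A -> K^o}) (S : {linear A -> A}) : Prop :=
  forall a, tlift (fun x y => S x * y) (delta a) = (eps a)%:A /\
            tlift (fun x y => x * S y) (delta a) = (eps a)%:A.

Section Triangular.
Variables (D : braided_datum) (A : algType K) (i : double_map D A).
Variables (delta : {linear A -> tens A A}) (eps : {linear A -> K^o}).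

Definition triangular_bialgebra : Prop :=
  free_braided_double i /\ is_bialgebra delta eps /\
  [/\ forall h, delta (jH i h) = tmap (jH i) (jH i) (gdelta h),
      forall a, sub_VH i a -> tens_sub (sub_VH i) (sub_VH i) (delta a),
      forall a, sub_HF i a -> tens_sub (sub_HF i) (sub_HF i) (delta a),
      forall m a, natdeg i m a -> tens_natdeg i m (delta a)
    & forall m a, natdeg i m a -> m != 0 -> eps a = 0].

Definition triangular_hopf : Prop :=
  triangular_bialgebra /\
  exists S : {linear A -> A},
    [/\ is_antipode delta eps S,
        forall m a, natdeg i m a -> natdeg i m (S a),
        forall a, sub_VH i a -> sub_VH i (S a)
      & forall a, sub_HF i a -> sub_HF i (S a)].

Section Degrees.
Variables (W : vectType K) (j : W -> A).

(* For j = jV i or jF i: x, resp. y, is the image of w under the right, resp.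
   left, coaction, i.e. the component in W ⊗ H, resp. H ⊗ W, of the coproduct
   of w, which lies in W ⊗ H + H ⊗ W. *)
Definition right_coaction (w : W) (x : tens W H) : Prop :=
  exists y : tens H W, delta (j w) = tmap j (jH i) x + tmap (jH i) j y.
Definition left_coaction (w : W) (y : tens H W) : Prop :=
  exists x : tens W H, delta (j w) = tmap j (jH i) x + tmap (jH i) j y.

Definition right_degree (w : W) (g : G) : Prop :=
  right_coaction w (w ⊗ ggen K g).
Definition left_degree (w : W) (g : G) : Prop :=
  left_coaction w (ggen K g ⊗ w).

Definition distinct_degrees (deg : W -> G -> Prop) : Prop :=
  exists (e : (\dim {:W}).-tuple W) (d : 'I_(\dim {:W}) -> G),
    [/\ basis_of {:W} e, forall r, deg (tnth e r) (d r) & injective d].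

End Degrees.

Definition weakly_separable : Prop :=
  [/\ distinct_degrees (right_degree (jV i)),
      distinct_degrees (left_degree (jV i)),
      distinct_degrees (right_degree (jF i))
    & distinct_degrees (left_degree (jF i))].

End Triangular.

Definition subcoalgebra (A : lmodType K) (delta : A -> tens A A)
    (C : A -> Prop) : Prop :=
  [/\ C 0, forall c a b, C a -> C b -> C (c *: a + b)
    & forall a, C a -> tens_sub C C (delta a)].

Definition indecomposable (A : lmodType K) (delta : A -> tens A A) : Prop :=
  forall C D : A -> Prop, subcoalgebra delta C -> subcoalgebra delta D ->
    (forall a, exists c d, [/\ C c, D d & a = c + d]) ->
    (forall a, C a -> D a -> a = 0) ->
    (forall a, C a -> a = 0) \/ (forall a, D a -> a = 0).

Definition generates (X : G -> Prop) : Prop :=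
  forall S : {pred G}, group_closed S ->
    (forall x, X x -> x \in S) -> forall g, g \in S.

(* g |> v_r = lambda_r(g) v_(g(r)), with s g r = g(r) *)
Definition left_characters (D : braided_datum) (n : nat)
    (v : n.-tuple (bdV D)) (lambda : 'I_n -> G -> K)
    (s : G -> 'I_n -> 'I_n) : Prop :=
  forall g r, bdact (ggen K g) (tnth v r) = lambda r g *: tnth v (s g r).

(* f_r <| g = mu_r(g) f_(g(r)), with s g r = g(r) *)
Definition right_characters (D : braided_datum) (n : nat)
    (f : n.-tuple (dual K (bdV D))) (mu : 'I_n -> G -> K)
    (s : G -> 'I_n -> 'I_n) : Prop :=
  forall g r, ract (tnth f r) (ggen K g) = mu r g *: tnth f (s g r).

End FreeBraidedDoubles.

(* Main.v *)
Require Import Defs.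
From HB Require Import structures.
From mathcomp Require Import all_boot all_order all_algebra.

Set Implicit Arguments.
Unset Strict Implicit.
Unset Printing Implicit Defensive.

Import GRing.Theory.
Local Open Scope ring_scope.

(** Both generators become skew-primitive as soon as they are homogeneous on
the two sides. Let (e_r) be a basis of W = V or W = V^*, homogeneous for the
right grading, of pairwise distinct degrees d_r. The left and right coactions
commute, so the left coaction preserves the lines K e_r, and each e_r is also
homogeneous on the left: Delta(e_r) = e_r ⊗ d_r + h_r ⊗ e_r with h_r in G
([right_degree_bihomogeneous]). Multiplying e_r on the right by a group
element x multiplies both degrees by x, and the choices x = h_r^-1 on V and
x = d_r^-1 on V^* give the required shapes, with k_r = d_r h_r^-1 and
l_s = h'_s d'_s^-1, where primes denote the degrees on V^*.

Conjugation by G conjugates the degrees. As these are distinct, G permutes the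
lines K e_r ([bihomogeneous_basis_conj]), which provides the characters.

The commutation of k_r with l_s and the relation between the characters come
from f v - v f lying in H. Its coproduct lies in H ⊗ H, so the two components
of Delta(f) Delta(v) - Delta(v) Delta(f) in which f and v stand on different
sides of the tensor sign vanish ([cross_degrees]). One of them says that
(f <| h) ⊗ (d' |> v) = f ⊗ v, the other that (h' |> v) ⊗ (f <| d) = v ⊗ f.
Hence v is an eigenvector of d' and h', which therefore commute with d and h,
f is an eigenvector of h and d, and the eigenvalues on the two sides are
inverse to each other.

For the generation of G, let S be a subgroup containing all k_r and l_s. By
triangularity A is spanned by the products v_I g f_J in the skew-primitive
generators, with g in G. The coproduct of such a product involves only
products whose group element is obtained from g by multiplying by some k_r on
the left and some l_s on the right, so the products with g in S and those with
g outside S span two subcoalgebras with sum A ([block_subcoalgebra],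
[block_split]). They meet in 0, because the operator a |-> q(a_1) a_2, where q
reads on the H-part of the triangular decomposition whether the group element
is in S, is the identity on the first and 0 on the second ([block_eigen]). As
A is indecomposable and the first one contains 1, the second one vanishes,
that is, S = G.

Elements of A ⊗ A are compared throughout by linear functionals on A that
read off one component of the triangular decomposition
([pbw_functional]). *)

(** * Contraction of tensors by functionals *)

Section Contraction.
Variables (K : fieldType) (U V Z : lmodType K).

Lemma tpureDl (u u' : U) (v : V) : (u + u') ⊗ v = u ⊗ v + u' ⊗ v.
Proof. by have := (tpure_bilin U V).1 v 1 u u'; rewrite !scale1r. Qed.
Lemma tpureDr (u : U) (v v' : V) : u ⊗ (v + v') = u ⊗ v + u ⊗ v'.
Proof. by have := (tpure_bilin U V).2 u 1 v v'; rewrite !scale1r. Qed.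
Lemma tpure0l (v : V) : (0 : U) ⊗ v = 0.
Proof. by apply: (addIr ((0 : U) ⊗ v)); rewrite -tpureDl !add0r. Qed.
Lemma tpure0r (u : U) : u ⊗ (0 : V) = 0.
Proof. by apply: (addIr (u ⊗ (0 : V))); rewrite -tpureDr !add0r. Qed.
Lemma tpureZl c (u : U) (v : V) : (c *: u) ⊗ v = c *: (u ⊗ v).
Proof.
by have := (tpure_bilin U V).1 v c u 0; rewrite /= tpure0l !addr0.
Qed.
Lemma tpureZr c (u : U) (v : V) : u ⊗ (c *: v) = c *: (u ⊗ v).
Proof.
by have := (tpure_bilin U V).2 u c v 0; rewrite /= tpure0r !addr0.
Qed.

Lemma tens_span (x : tens U V) :
  exists s : seq (U * V), x = \sum_(p <- s) (p.1 ⊗ p.2).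
Proof.
elim/tens_ind: x => [u v|c x y [s ->] [t ->]|].
- by exists [:: (u, v)]; rewrite big_seq1.
- exists ([seq (c *: p.1, p.2) | p <- s] ++ t).
  rewrite big_cat big_map /= scaler_sumr; congr (_ + _).
  by apply: eq_bigr => p _; rewrite tpureZl.
- by exists [::]; rewrite big_nil.
Qed.

Variables (q : {linear U -> K^o}) (f : {linear V -> Z}).

Definition contract : tens U V -> Z := tlift (fun u v => q u *: f v).

Lemma contract_bilin : bilin (fun u v => q u *: f v).
Proof.
split=> [v c u u'|u c v v']; rewrite linearP ?scalerDl ?scalerDr ?scalerA //.
by rewrite mulrC.
Qed.

Lemma contract_linear : linear contract.
Proof. exact: tlift_linear contract_bilin. Qed.
HB.instance Definition _ :=
  GRing.isLinear.Build K (tens U V) Z _ contract contract_linear.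

Lemma contractE u v : contract (u ⊗ v) = q u *: f v.
Proof. exact: tliftE contract_bilin. Qed.

End Contraction.

Section ContractionMap.
Variables (K : fieldType).

Lemma tmap_sum (U V U' V' : lmodType K) (f : {linear U -> U'})
  (g : {linear V -> V'}) (s : seq (U * V)) :
  tmap f g (\sum_(p <- s) (p.1 ⊗ p.2)) = \sum_(p <- s) (f p.1 ⊗ g p.2).
Proof.
have lt : linear (tmap f g).
  by apply: tlift_linear; apply: tmap_bilin; exact: linearP.
elim: s => [|p s ih].
  by rewrite !big_nil; have := lt (-1) 0 0; rewrite scaler0 addr0 scaleN1r addNr.
rewrite !big_cons -ih -[X in tmap f g (X + _)]scale1r lt scale1r tmapE //;
  exact: linearP.
Qed.

Lemma contract_tmap (U V U' V' Z : lmodType K) (f : {linear U -> U'})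
    (g : {linear V -> V'}) (q : {linear U' -> K^o}) (p : {linear V' -> Z}) z :
  contract q p (tmap f g z) = contract (q \o f) (p \o g) z.
Proof.
have [s ->] := tens_span z; rewrite tmap_sum !linear_sum.
by apply: eq_bigr => x _; rewrite /= !contractE.
Qed.

Lemma contract_tassoc (U V W Z : lmodType K) (q : {linear U -> K^o})
    (p : {linear V -> K^o}) (r : {linear W -> Z}) z :
  contract q (contract p r) (tassoc z) = contract (contract q p) r z.
Proof.
have la : linear (@tassoc K U V W).
  apply: tlift_linear; apply: bilin_tlift => [w|u v c w w'].
    apply: (@tmap_bilin K U V U (tens V W) id (fun v => v ⊗ w)) => //.
    exact: (tpure_bilin _ _).1.
  by rewrite (tpure_bilin _ _).2 (tpure_bilin _ _).2.
elim/tens_ind: z => [x w|c x y hx hy|].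
- elim/tens_ind: x => [u v|c x y hx hy|].
  + by rewrite tassocE !contractE /= !contractE -scalerA.
  + by rewrite tpureDl tpureZl la !linearP /= hx hy.
  + rewrite tpure0l linear0.
    have := la (-1) 0 0; rewrite scaler0 addr0 scaleN1r addNr => ->.
    by rewrite linear0.
- by rewrite la !linearP /= hx hy.
- rewrite linear0.
  have := la (-1) 0 0; rewrite scaler0 addr0 scaleN1r addNr => ->.
  by rewrite linear0.
Qed.

Lemma eq_contract (U V Z : lmodType K) (q q' : {linear U -> K^o})
    (f f' : {linear V -> Z}) : q =1 q' -> f =1 f' ->
  contract q f =1 contract q' f'.
Proof.
move=> hq hf z; elim/tens_ind: z => [u v|c x y hx hy|].
- by rewrite !contractE hq hf.
- by rewrite !linearP /= hx hy.
- by rewrite !linear0.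
Qed.
End ContractionMap.

Section TensorSquare.
Variables (K : fieldType) (A B : algType K).

Lemma tens_mulE (a c : A) (b d : B) : (a ⊗ b) * (c ⊗ d) = (a * c) ⊗ (b * d).
Proof. exact: tmulE. Qed.

Lemma tens_scaleAl c (x y : tens A B) : (c *: x) * y = c *: (x * y).
Proof. by have := tmulPl c x 0 y; rewrite tmul0l !addr0. Qed.
Lemma tens_scaleAr c (x y : tens A B) : x * (c *: y) = c *: (x * y).
Proof. by have := tmulPr c x y 0; rewrite tmul0r !addr0. Qed.

End TensorSquare.

(** * Coefficients in the group algebra *)

Lemma regular_scaleE (K : fieldType) (c x : K) :
  c *: (x : K^o) = c * x :> K.
Proof. by []. Qed.

Section GroupAlgebraFunctionals.
Variables (K : fieldType) (G : groupType).
Local Notation H := (galg K G).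

Definition gcoef (P : {pred G}) : {linear H -> K^o} :=
  glift (fun x => (x \in P)%:R : K^o).

Lemma gcoefE (P : {pred G}) g : gcoef P (ggen K g) = (g \in P)%:R.
Proof. exact: gliftE. Qed.

Lemma ggenM (g h : G) : ggen K (g * h)%g = ggen K g * ggen K h.
Proof. by rewrite -[RHS]/(gmul _ _) gmul_gen. Qed.

(** The sum runs over the group elements of one representative of a; the
coefficients of a vanish outside it. *)
Lemma galg_coefE (a : H) :
  exists s : seq G, a = \sum_(g <- s) (gcoef (pred1 g) a : K) *: ggen K g.
Proof.
pose s := repr a; exists (undup (unzip2 s)).
have ea : a = \sum_(p <- s) p.1 *: ggen K p.2 by exact: uspaceE.
rewrite {1}ea {1}ea.
under [RHS]eq_bigr => g _ do rewrite linear_sum scaler_suml.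
rewrite exchange_big /= !big_seq; apply: eq_bigr => p ps.
rewrite (bigD1_seq p.2) ?undup_uniq ?mem_undup ?map_f //=.
rewrite big1 ?addr0 => [|g gp]; rewrite linearZ /= gcoefE inE.
  by rewrite eqxx regular_scaleE mulr1.
by rewrite eq_sym (negPf gp) regular_scaleE mulr0 scale0r.
Qed.

Lemma galg_coef0 (a : H) : (forall g, gcoef (pred1 g) a = 0) -> a = 0.
Proof.
move=> h; have [s ->] := galg_coefE a.
by apply: big1 => g _; rewrite h scale0r.
Qed.

Lemma gdeltaE g : gdelta (ggen K g) = ggen K g ⊗ ggen K g :> tens H H.
Proof. exact: gliftE. Qed.

Lemma gdelta_linear : linear (@gdelta K G).
Proof. exact: linearP. Qed.
HB.instance Definition _ :=
  GRing.isLinear.Build K H (tens H H) _ (@gdelta K G) gdelta_linear.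

(** Comparing the coefficients of x ⊗ y in a ⊗ a and in the coproduct of a
gives a_x a_y = 0 for x different from y and a_x^2 = a_x. Hence a single
coefficient is nonzero, and it is 1. *)
Lemma galg_grouplike (a : H) : a != 0 ->
  (forall x y, gcoef (pred1 x) a * gcoef (pred1 y) a =
     contract (gcoef (pred1 x)) (gcoef (pred1 y)) (gdelta a)) ->
  exists g, a = ggen K g.
Proof.
move=> a0 ha.
have hd x y : contract (gcoef (pred1 x)) (gcoef (pred1 y)) (gdelta a)
    = (x == y)%:R * gcoef (pred1 x) a.
  elim/galg_ind: a {a0 ha} => [g|c a b ea eb|].
  - rewrite gdeltaE contractE !gcoefE !inE.
    case: (eqVneq x y) => [->|xy].
      by rewrite mul1r; case: (g == y); rewrite ?scale0r ?scale1r.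
    case: (eqVneq g x) => [->|_]; last by rewrite scale0r mulr0.
    by rewrite scale1r (negPf xy) mul0r.
  - by rewrite !linearP /= ea eb mulrDr /GRing.scale /= mulrCA.
  - by rewrite !linear0 mulr0.
have [g ag] : exists g, gcoef (pred1 g) a != 0.
  have [//|h] := boolp.EM (exists g, gcoef (pred1 g) a != 0).
  case/eqP: a0; apply: galg_coef0 => g.
  by apply/eqP; apply: contra_notT h => ag; exists g.
exists g; apply/eqP; rewrite -subr_eq0; apply/eqP/galg_coef0 => x.
rewrite linearB /= gcoefE inE eq_sym; apply/eqP; rewrite subr_eq0; apply/eqP.
have := ha x g; rewrite hd; case: eqVneq => [->|_] /=.
  by rewrite mul1r -[RHS]mul1r => /(mulIf ag).
by rewrite mul0r => /eqP; rewrite mulf_eq0 (negPf ag) orbF => /eqP.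
Qed.

End GroupAlgebraFunctionals.

(** * The triangular decomposition *)

(** The condition under which a function of words descends to T(V). *)
Definition multilinear_word (K : fieldType) (V : lmodType K)
    (a : seq V -> K^o) : Prop :=
  forall s1 s2 : seq V, linear (fun v => a (s1 ++ v :: s2)).

Section Words.
Variables (K : fieldType) (V : lmodType K).

(** On T(V), [word0] becomes the projection to degree 0, and [word1 phi] the
projection to V followed by phi. *)
Definition word0 (s : seq V) : K^o := if s is [::] then 1 else 0.
Definition word1 (phi : V -> K^o) (s : seq V) : K^o :=
  if s is [:: v] then phi v else 0.

Lemma word0_multilinear : multilinear_word word0.
Proof. by case=> [|v s1] s2 c u u' /=; rewrite scaler0 addr0. Qed.

Lemma word1_multilinear (phi : {linear V -> K^o}) :
  multilinear_word (word1 phi).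
Proof.
by move=> [|v [|w s1]] [|x s2] c u u' /=; rewrite ?linearP ?scaler0 ?addr0.
Qed.

Definition word_lift (a : seq V -> K^o) (ha : multilinear_word a) :
  talg V -> K^o := ulift a.

Section Lift.
Variables (a : seq V -> K^o) (ha : multilinear_word a).

Lemma word_lift_linear : linear (word_lift ha).
Proof. exact: ulift_linear. Qed.
HB.instance Definition _ :=
  GRing.isLinear.Build K (talg V) K^o _ (word_lift ha) word_lift_linear.

Lemma word_liftE s : word_lift ha (tword s) = a s.
Proof. exact: ulift_gen. Qed.
End Lift.

End Words.

Section PBW.
Variables (K : fieldType) (G : groupType) (D : braided_datum K G).
Variables (A : algType K) (i : double_map D A).
Local Notation H := (galg K G).
Local Notation V := (bdV D).
Local Notation F := (dual K (bdV D)).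

Definition pbw_word (s : seq V) (h : H) (t : seq F) : A :=
  \prod_(v <- s) jV i v * jH i h * \prod_(f <- t) jF i f.

Let talg_lift_lin (W : lmodType K) (j : {linear W -> A}) :
  linear (talg_lift j).
Proof. by apply: ulift_linear; apply: talg_liftP; exact: linearP. Qed.

Let mul_bilin (U W : lmodType K) (f : U -> A) (g : W -> A) :
  linear f -> linear g -> bilin (fun x y => f x * g y).
Proof.
move=> lf lg; split=> [y c x x'|x c y y']; rewrite ?lf ?lg.
  by rewrite mulrDl scalerAl.
by rewrite mulrDr scalerAr.
Qed.

Let bil_VH : bilin (fun t h => talg_lift (jV i) t * jH i h).
Proof. by apply: mul_bilin; [exact: talg_lift_lin | exact: linearP]. Qed.

Let bil_VHF : bilin (fun x s => mult_VH i x * talg_lift (jF i) s).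
Proof.
apply: mul_bilin; last exact: talg_lift_lin.
exact: tlift_linear bil_VH.
Qed.

Lemma mult_VHF_linear : linear (mult_VHF i).
Proof. exact: tlift_linear bil_VHF. Qed.

Lemma mult_VHF_word s h t :
  mult_VHF i (tword s ⊗ h ⊗ tword t) = pbw_word s h t.
Proof.
rewrite /mult_VHF (tliftE _ _ bil_VHF) /mult_VH (tliftE _ _ bil_VH).
by rewrite !talg_liftE //; exact: linearP.
Qed.

Hypothesis bij : bijective (mult_VHF i).

(** Surjectivity of the multiplication map gives this induction, its injectivity
gives the functionals of [pbw_functional]. *)
Lemma pbw_ind (Q : A -> Prop) :
  (forall s g t, Q (pbw_word s (ggen K g) t)) ->
  (forall c a b, Q a -> Q b -> Q (c *: a + b)) -> Q 0 ->
  forall a, Q a.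
Proof.
move=> Qw Ql Q0 a.
have lin0 (U : lmodType K) (f : U -> A) : linear f -> f 0 = 0.
  by move=> lf; have := lf (-1) 0 0; rewrite scaler0 addr0 scaleN1r addNr.
have ind (U : lmodType K) (f : U -> A) : linear f ->
    (Q (f 0)) * (forall c x y, Q (f x) -> Q (f y) -> Q (f (c *: x + y))).
  by move=> lf; split=> [|c x y hx hy]; rewrite ?lin0 // lf; exact: Ql.
have [m' _ mK] := bij; rewrite -[a]mK; elim/tens_ind: (m' a) => [x t|c x y|].
- pose f1 (t0 : talg F) := mult_VHF i (x ⊗ t0).
  have l1 : linear f1.
    by move=> c u u'; rewrite /f1 tpureDr tpureZr mult_VHF_linear.
  elim/uspace_ind: t => [t|c u u'|];
    [|exact: (ind _ f1 l1).2|exact: (ind _ f1 l1).1].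
  pose f2 x0 := mult_VHF i (x0 ⊗ tword t).
  have l2 : linear f2.
    by move=> c u u'; rewrite /f2 tpureDl tpureZl mult_VHF_linear.
  rewrite /f1 -/(f2 x) {f1 l1}.
  elim/tens_ind: x => [s h|c u u'|];
    [|exact: (ind _ f2 l2).2|exact: (ind _ f2 l2).1].
  pose f3 s0 := f2 (s0 ⊗ h).
  have l3 : linear f3 by move=> c u u'; rewrite /f3 tpureDl tpureZl l2.
  elim/uspace_ind: s => [s|c u u'|];
    [|exact: (ind _ f3 l3).2|exact: (ind _ f3 l3).1].
  pose f4 h0 := f2 (tword s ⊗ h0).
  have l4 : linear f4 by move=> c u u'; rewrite /f4 tpureDr tpureZr l2.
  rewrite -/(f4 h); elim/galg_ind: h f3 l3 => [g|c u u' hu hu'|] f3 l3;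
    [|apply: (ind _ f4 l4).2|exact: (ind _ f4 l4).1].
  + by rewrite /f4 /f2 mult_VHF_word.
  + exact: hu.
  + exact: hu'.
- exact: (ind _ _ mult_VHF_linear).2.
- exact: (ind _ _ mult_VHF_linear).1.
Qed.

Lemma pbw_functional (a : seq V -> K^o) (b : {linear H -> K^o})
    (c : seq F -> K^o) : multilinear_word a -> multilinear_word c ->
  exists L : {linear A -> K^o},
    forall s h t, L (pbw_word s h t) = (a s : K) * b h * c t.
Proof.
move=> ha hc; have [m' mK m'K] := bij.
have lm' : linear m'.
  by move=> k x y; apply: (bij_inj bij); rewrite mult_VHF_linear !m'K.
pose L0 := contract (contract (word_lift ha) b) (word_lift hc).
have lL : linear (L0 \o m') by move=> k x y /=; rewrite lm' /L0 linearP.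
pose Lm := GRing.isLinear.Build K A K^o _ _ lL.
pose L : {linear A -> K^o} := HB.pack (L0 \o m') Lm.
exists L => s h t; rewrite /L /= -mult_VHF_word mK /L0 !contractE /=.
by rewrite contractE /= !word_liftE.
Qed.

Lemma rel_gv g v :
  jH i (ggen K g) * jV i v = jV i (bdact (ggen K g) v) * jH i (ggen K g).
Proof.
rewrite rel_HV gdeltaE tliftE //; have [act_bilin _ _] := bdactP D.
apply: (@mul_bilin _ _ (fun h1 => jV i (bdact h1 v))); last exact: linearP.
by move=> c x y; rewrite act_bilin.1 linearP.
Qed.

Lemma ractE (f : F) h v : ract (D := D) f h v = f (bdact h v).
Proof.
have [act_bilin _ _] := bdactP D.
have lf : linear (fun v => f (bdact h v)).
  by move=> c x y; rewrite act_bilin.2 linearP.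
pose fM := GRing.isLinear.Build K V K^o _ _ lf.
pose fL : {linear V -> K^o} := HB.pack (fun v => f (bdact h v)) fM.
by rewrite /ract (lfunE fL).
Qed.

Lemma ract_linear (f : F) : linear (ract (D := D) f).
Proof.
have [act_bilin _ _] := bdactP D; move=> c x y; apply/lfunP => v.
by rewrite add_lfunE scale_lfunE !ractE act_bilin.1 linearP.
Qed.

Lemma rel_fg f g :
  jF i f * jH i (ggen K g) = jH i (ggen K g) * jF i (ract f (ggen K g)).
Proof.
rewrite rel_FH gdeltaE tliftE //.
apply: (@mul_bilin _ _ (jH i) (fun h2 => jF i (ract f h2))); first exact: linearP.
by move=> c x y; rewrite ract_linear linearP.
Qed.

End PBW.

(** * Homogeneous generators *)

Section Convolution.
Variables (K : fieldType) (A : algType K).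
Variables (delta : {linear A -> tens A A}) (eps : {linear A -> K^o}).
Hypothesis coalg : is_coalgebra delta eps.

Lemma convA (Z : lmodType K) (q p : {linear A -> K^o}) (r : {linear A -> Z}) a :
  contract q (contract p r \o delta) (delta a)
  = contract (contract q p \o delta) r (delta a).
Proof.
have [coassoc _ _] := coalg.
transitivity (contract q (contract p r) (tmap idfun delta (delta a))).
  by rewrite contract_tmap; apply: eq_contract.
have -> : tmap idfun delta (delta a) = tassoc (tmap delta idfun (delta a)).
  exact/esym/coassoc.
by rewrite contract_tassoc contract_tmap; apply: eq_contract.
Qed.

Lemma conv_eps a : contract eps idfun (delta a) = a.
Proof. by have [_ counit _] := coalg; exact: counit. Qed.

End Convolution.

Lemma tens_basis (K : fieldType) (U : lmodType K) (W : vectType K) m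
    (e : m.-tuple W) (x : tens U W) : basis_of {:W} e ->
  exists z : 'I_m -> U, x = \sum_s (z s ⊗ tnth e s).
Proof.
move=> be; elim/tens_ind: x => [u w|c x y [zx ->] [zy ->]|].
- exists (fun s => coord e s w *: u).
  rewrite {1}(coord_basis be (memvf w)); elim/big_rec2: _ => [|s y1 y2 _ <-].
    by rewrite tpure0r.
  by rewrite tpureDr tpureZr tpureZl -tnth_nth.
- exists (fun s => c *: zx s + zy s).
  rewrite scaler_sumr -big_split /=; apply: eq_bigr => s _.
  by rewrite tpureDl tpureZl.
- by exists (fun=> 0); rewrite big1 // => s _; rewrite tpure0l.
Qed.

Lemma coord_tnth (K : fieldType) (W : vectType K) m (e : m.-tuple W) s t :
  basis_of {:W} e -> coord e t (tnth e s) = (s == t)%:R.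
Proof. by move=> /basis_free fe; rewrite (tnth_nth 0) coord_free. Qed.

Section Homogeneous.
Variables (K : fieldType) (G : groupType) (D : braided_datum K G).
Variables (A : algType K) (i : double_map D A).
Variables (delta : {linear A -> tens A A}) (eps : {linear A -> K^o}).
Variables (W : vectType K) (j : {linear W -> A}).
Local Notation H := (galg K G).

(** The images of W and H in A are independent, in the form in which it is used:
a functional on either one extends to A by 0 on the other. *)
Definition separated : Prop :=
  (forall phi : {linear W -> K^o}, exists L : {linear A -> K^o},
     (forall w, L (j w) = phi w) /\ (forall h, L (jH i h) = 0)) /\
  (forall beta : {linear H -> K^o}, exists L : {linear A -> K^o},
     (forall h, L (jH i h) = beta h) /\ (forall w, L (j w) = 0)).

Hypothesis coalg : is_coalgebra delta eps.
Hypothesis deltaH : forall h, delta (jH i h) = tmap (jH i) (jH i) (gdelta h).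
Hypothesis sep : separated.

Definition bihomogeneous (w : W) (d h : G) : Prop :=
  delta (j w) = j w ⊗ jH i (ggen K d) + jH i (ggen K h) ⊗ j w.

(** Write Delta(e_r) = e_r ⊗ d_r + sum_t z_t ⊗ e_t with z_t in H. The component
of coassociativity in H ⊗ W ⊗ H reads sum_t z_t ⊗ e_t ⊗ (d_t - d_r) = 0, so
z_t = 0 for t <> r because the degrees are distinct. The component in
H ⊗ H ⊗ W then says that z_r is grouplike, once the counit shows that it is
not 0. *)
Lemma right_degree_bihomogeneous m (e : m.-tuple W) (d : 'I_m -> G) :
  basis_of {:W} e -> injective d ->
  (forall r, right_degree i delta j (tnth e r) (d r)) ->
  forall r, exists h, bihomogeneous (tnth e r) (d r) h.
Proof.
move=> be inj_d deg_e.
have [cW cH] := sep.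
have delta_e (s : 'I_m) : exists z : 'I_m -> H, delta (j (tnth e s)) =
    j (tnth e s) ⊗ jH i (ggen K (d s)) + \sum_t (jH i (z t) ⊗ j (tnth e t)).
  have [y] := deg_e s; have [z ->] := tens_basis y be => dE.
  exists z; rewrite dE tmapE; [|exact: linearP|exact: linearP].
  congr (_ + _).
  have := tmap_sum (jH i) j [seq (z t, tnth e t) | t <- index_enum 'I_m].
  by rewrite !big_map.
have conv_e s (z : 'I_m -> H) : delta (j (tnth e s)) =
    j (tnth e s) ⊗ jH i (ggen K (d s)) + \sum_t (jH i (z t) ⊗ j (tnth e t)) ->
    forall (Z : lmodType K) (q : {linear A -> K^o}) (p : {linear A -> Z}),
    contract q p (delta (j (tnth e s))) =
    q (j (tnth e s)) *: p (jH i (ggen K (d s)))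
    + \sum_t q (jH i (z t)) *: p (j (tnth e t)).
  move=> -> Z q p; rewrite linearD linear_sum /= contractE.
  by congr (_ + _); apply: eq_bigr => t _; rewrite contractE.
move=> r; have [z dE] := delta_e r; have zE := conv_e _ _ dE.
(* the component in H ⊗ W ⊗ H *)
have z0 t : t != r -> z t = 0.
  move=> tr; apply: galg_coef0 => x.
  have [L [Lh Lw]] := cH (gcoef K (pred1 x)).
  have [M [Mw Mh]] := cW (coord e t).
  have [N [Nh Nw]] := cH (gcoef K (pred1 (d r))).
  have MN s : contract M N (delta (j (tnth e s))) = ((s == t) && (s == r))%:R.
    have [z' /conv_e ->] := delta_e s.
    rewrite big1 => [|u _]; last by rewrite Mh scale0r.
    rewrite addr0 Mw Nh /= gcoefE inE (inj_eq inj_d) coord_tnth //.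
    by case: (s == t); rewrite ?scale1r ?scale0r.
  have := convA coalg L M N (j (tnth e r)).
  rewrite !zE /= Lw scale0r add0r zE Lw scale0r add0r.
  rewrite Nh gcoefE inE eqxx.
  rewrite big1 => [|s _]; last first.
    rewrite MN; case: eqP => [->|_]; last by rewrite scaler0.
    by rewrite (negPf tr) scaler0.
  rewrite (bigD1 t) //= big1 => [|s st]; last first.
    by rewrite Mw /= coord_tnth // (negPf st) scaler0.
  rewrite Mw /= coord_tnth // eqxx Lh addr0.
  rewrite big1 => [|s _]; last by rewrite Nw scaler0.
  by rewrite addr0 !regular_scaleE !mulr1.
have {}zE (Z : lmodType K) (q : {linear A -> K^o}) (p : {linear A -> Z}) :
    contract q p (delta (j (tnth e r))) =
    q (j (tnth e r)) *: p (jH i (ggen K (d r)))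
    + q (jH i (z r)) *: p (j (tnth e r)).
  rewrite zE (bigD1 r) //= big1 ?addr0 // => s sr.
  by rewrite z0 // !linear0 scale0r.
have [N [Nw Nh]] := cW (coord e r).
have Nr : N (j (tnth e r)) = 1 by rewrite Nw /= coord_tnth // eqxx.
have zr0 : z r != 0.
  apply/eqP => zr; have := conv_eps coalg (j (tnth e r)).
  rewrite zE zr !linear0 scale0r addr0 => /(congr1 N).
  rewrite linearZ /= Nh scaler0 Nr => /eqP.
  by rewrite eq_sym oner_eq0.
have [h hE] : exists h, z r = ggen K h.
  (* the component in H ⊗ H ⊗ W *)
  apply: galg_grouplike => // x y.
  have [L [Lh Lw]] := cH (gcoef K (pred1 x)).
  have [M [Mh Mw]] := cH (gcoef K (pred1 y)).
  have := convA coalg L M N (j (tnth e r)).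
  rewrite !zE /= Lw scale0r add0r zE Nh Mw scale0r scaler0 !add0r Nr Lh Mh.
  rewrite deltaH contract_tmap !regular_scaleE !mulr1 => ->.
  by apply: eq_contract.
exists h; rewrite /bihomogeneous dE (bigD1 r) //= hE big1 ?addr0 // => s sr.
by rewrite z0 // linear0 tpure0l.
Qed.
Local Notation gr x := (jH i (ggen K x)).

Lemma gr1 : gr 1%g = 1.
Proof. exact: rmorph1. Qed.

Lemma grM x y : gr (x * y)%g = gr x * gr y.
Proof. by rewrite ggenM rmorphM. Qed.

Lemma grVK x a : gr x^-1%g * (gr x * a) = a.
Proof. by rewrite mulrA -grM mulVg gr1 mul1r. Qed.

Lemma grKV x a : gr x * (gr x^-1%g * a) = a.
Proof. by rewrite mulrA -grM mulgV gr1 mul1r. Qed.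

Lemma delta_gr x : delta (gr x) = gr x ⊗ gr x.
Proof. by rewrite deltaH gdeltaE tmapE //; exact: linearP. Qed.

(** The degrees of an element can be compared with those of the basis elements
in its support by applying coord_r ⊗ coef_x and coef_y ⊗ coord_r to the two
expressions of its coproduct. *)
Lemma bihomogeneous_coord m (e : m.-tuple W) (d h : 'I_m -> G) w x y :
  basis_of {:W} e -> (forall r, bihomogeneous (tnth e r) (d r) (h r)) ->
  bihomogeneous w x y ->
  forall r, coord e r w != 0 -> d r = x /\ h r = y.
Proof.
move=> be he hw r wr0; have [cW cH] := sep.
have [M [Mw Mh]] := cW (coord e r).
have wE : w = \sum_s coord e s w *: tnth e s.
  rewrite {1}(coord_basis be (memvf w)).
  by apply: eq_bigr => s _; rewrite -tnth_nth.
have E (b : bool) : coord e r w * b%:R = coord e r w -> b.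
  case: b => //; rewrite mulr0 => /esym/eqP; by rewrite (negPf wr0).
have sumE (c : 'I_m -> K) : \sum_s coord e s w * (c s * (s == r)%:R)
    = coord e r w * c r.
  rewrite (bigD1 r) //= eqxx mulr1 big1 ?addr0 // => s sr.
  by rewrite (negPf sr) !mulr0.
split; apply/eqP.
- have [N [Nh Nw]] := cH (gcoef K (pred1 x)).
  apply: E; rewrite -(sumE (fun s => (d s == x)%:R)).
  have := congr1 (contract M N) hw.
  rewrite !linearD /= !contractE Mh scale0r addr0 Nh gcoefE inE eqxx Mw /=.
  rewrite regular_scaleE mulr1 => <-; rewrite [in RHS]wE !linear_sum /=.
  apply: eq_bigr => s _; rewrite !linearZ /= (he s) linearD /= !contractE.
  rewrite Mh scale0r addr0 Nh gcoefE inE Mw /= coord_tnth //.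
  by rewrite !regular_scaleE (mulrC (d s == x)%:R).
- have [N [Nh Nw]] := cH (gcoef K (pred1 y)).
  apply: E; rewrite -(sumE (fun s => (h s == y)%:R)).
  have := congr1 (contract N M) hw.
  rewrite !linearD /= !contractE Nw scale0r add0r Nh gcoefE inE eqxx Mw /=.
  rewrite scale1r => <-; rewrite [in RHS]wE !linear_sum /=.
  apply: eq_bigr => s _; rewrite !linearZ /= (he s) linearD /= !contractE.
  rewrite Nw scale0r add0r Nh gcoefE inE Mw /= coord_tnth //.
Qed.

Lemma shifted_span m (e : m.-tuple W) (a : 'I_m -> G) w :
  basis_of {:W} e ->
  exists (c : 'I_m -> K) (x : 'I_m -> G),
    j w = \sum_r c r *: (j (tnth e r) * gr (a r) * gr (x r)).
Proof.
move=> be; exists (fun r => coord e r w), (fun r => (a r)^-1%g).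
rewrite {1}(coord_basis be (memvf w)) linear_sum; apply: eq_bigr => r _.
by rewrite linearZ /= -tnth_nth -mulrA -grM mulgV gr1 mulr1.
Qed.

Hypothesis deltaM : monoid_morphism delta.

Lemma delta_shifted w d h x : bihomogeneous w d h ->
  delta (j w * gr x) =
  (j w * gr x) ⊗ gr (d * x)%g + gr (h * x)%g ⊗ (j w * gr x).
Proof. by move=> hw; rewrite deltaM.2 hw delta_gr mulrDl !tens_mulE !grM. Qed.

(* The action of G on W, read inside A. *)
Hypothesis stable : forall x w, exists w', gr x * j w = j w' * gr x.

Lemma bihomogeneous_conj x w w' d h : gr x * j w = j w' * gr x ->
  bihomogeneous w d h ->
  bihomogeneous w' (x * d * x^-1)%g (x * h * x^-1)%g.
Proof.
move=> ww' hw.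
have jw' : j w' = gr x * j w * gr x^-1%g.
  by rewrite ww' -mulrA -grM mulgV gr1 mulr1.
rewrite /bihomogeneous jw' !deltaM.2 hw !delta_gr mulrDr mulrDl !tens_mulE.
by rewrite -!grM.
Qed.

(** Conjugation by x conjugates the degrees of e_r, and rescaling e_r does not
change them. *)
Lemma eigenvector_commute m (e : m.-tuple W) (d h : 'I_m -> G) x r p :
  basis_of {:W} e -> (forall r, bihomogeneous (tnth e r) (d r) (h r)) ->
  p != 0 -> gr x * j (tnth e r) = j (p *: tnth e r) * gr x ->
  commute x (d r) /\ commute x (h r).
Proof.
move=> be he p0 ex.
have [|dx hx] := bihomogeneous_coord be he (bihomogeneous_conj ex (he r)) (r := r).
  by rewrite linearZ /= coord_tnth // eqxx mulr1.
by rewrite /commute {2}dx {2}hx !mulgVK.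
Qed.

(** The conjugate of e_r is right homogeneous of degree x d_r x^-1, and distinct
degrees leave room for only one basis element in its support. *)
Lemma bihomogeneous_basis_conj m (e : m.-tuple W) (d h : 'I_m -> G) :
  basis_of {:W} e -> injective d ->
  (forall r, bihomogeneous (tnth e r) (d r) (h r)) ->
  forall x r w', gr x * j (tnth e r) = j w' * gr x ->
  exists c s, w' = c *: tnth e s /\
    (c != 0 -> d s = (x * d r * x^-1)%g /\ h s = (x * h r * x^-1)%g).
Proof.
move=> be inj_d he x r w' ew'.
have hw' := bihomogeneous_conj ew' (he r).
have cE := bihomogeneous_coord be he hw'.
have wE : w' = \sum_s coord e s w' *: tnth e s.
  rewrite {1}(coord_basis be (memvf w')).
  by apply: eq_bigr => s _; rewrite -tnth_nth.
case: (pickP (fun s => coord e s w' != 0)) => [s s0|w0].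
  exists (coord e s w'), s; split=> [|_]; last exact: cE.
  rewrite {1}wE (bigD1 s) //= big1 ?addr0 // => t ts.
  have [->|t0] := eqVneq (coord e t w') 0; first by rewrite scale0r.
  case/eqP: ts; apply: inj_d.
  by have [-> _] := cE _ t0; have [-> _] := cE _ s0.
exists 0, r; rewrite eqxx; split=> //.
rewrite scale0r wE big1 // => s _.
by have /negbFE/eqP -> := w0 s; rewrite scale0r.
Qed.

(** The hypothesis on the shift a covers both a_r = h_r^-1, which is used on V,
and a_r = d_r^-1, which is used on V^*. *)
Lemma shifted_basis_conj m (e : m.-tuple W) (d h a : 'I_m -> G) :
  basis_of {:W} e -> injective d ->
  (forall r, bihomogeneous (tnth e r) (d r) (h r)) ->
  (forall r s x, d s = (x * d r * x^-1)%g -> h s = (x * h r * x^-1)%g ->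
     a s = (x * a r * x^-1)%g) ->
  forall x r, exists c s,
    gr x * (j (tnth e r) * gr (a r)) = c *: (j (tnth e s) * gr (a s)) * gr x.
Proof.
move=> be inj_d he ha x r; have [w' ew'] := stable x (tnth e r).
have [c [s [wE cE]]] := bihomogeneous_basis_conj be inj_d he ew'.
exists c, s; rewrite mulrA ew' wE linearZ /= -!scalerAl.
have [->|/cE[ds hs]] := eqVneq c 0; first by rewrite !scale0r.
by rewrite (ha _ _ _ ds hs) -!mulrA -!grM mulgVK.
Qed.

End Homogeneous.

(** * Skew-primitive generators and subcoalgebras *)

Section TensSub.
Variables (K : fieldType) (A : algType K) (C : A -> Prop).
Hypothesis Clin : forall c a b, C a -> C b -> C (c *: a + b).
Hypothesis C0 : C 0.

Lemma tens_sub_pure a b : C a -> C b -> tens_sub C C (a ⊗ b).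
Proof.
move=> Ca Cb; exists [:: (a, b)]; rewrite big_seq1; split=> // p.
by rewrite inE => /eqP ->.
Qed.

Lemma tens_sub_lin c x y :
  tens_sub C C x -> tens_sub C C y -> tens_sub C C (c *: x + y).
Proof.
move=> [s [-> hs]] [t [-> ht]].
exists ([seq (c *: p.1, p.2) | p <- s] ++ t); split.
  rewrite big_cat big_map /= scaler_sumr; congr (_ + _).
  by apply: eq_bigr => p _; rewrite tpureZl.
move=> p; rewrite mem_cat => /orP[/mapP[p' /hs[h1 h2] ->]|/ht //].
by split=> //=; rewrite -[_ *: _]addr0; apply: Clin.
Qed.

Lemma tens_sub0 : tens_sub C C 0.
Proof. by exists [::]; rewrite big_nil. Qed.

Lemma tens_subD x y :
  tens_sub C C x -> tens_sub C C y -> tens_sub C C (x + y).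
Proof. by move=> hx hy; rewrite -[x]scale1r; apply: tens_sub_lin. Qed.

Lemma tens_sub_mull a b x : (forall y, C y -> C (a * y)) ->
  (forall y, C y -> C (b * y)) ->
  tens_sub C C x -> tens_sub C C ((a ⊗ b) * x).
Proof.
move=> ha hb [s [-> hs]]; rewrite mulr_sumr big_seq.
elim/big_rec: _ => [|p y /hs[Cp1 Cp2] hy]; first exact: tens_sub0.
by rewrite tens_mulE; apply: tens_subD => //; apply: tens_sub_pure; auto.
Qed.

Lemma tens_sub_mulr a b x : (forall y, C y -> C (y * a)) ->
  (forall y, C y -> C (y * b)) ->
  tens_sub C C x -> tens_sub C C (x * (a ⊗ b)).
Proof.
move=> ha hb [s [-> hs]]; rewrite mulr_suml big_seq.
elim/big_rec: _ => [|p y /hs[Cp1 Cp2] hy]; first exact: tens_sub0.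
by rewrite tens_mulE; apply: tens_subD => //; apply: tens_sub_pure; auto.
Qed.

End TensSub.

Section Blocks.
Variables (K : fieldType) (G : groupType) (D : braided_datum K G).
Variables (A : algType K) (i : double_map D A).
Variables (delta : {linear A -> tens A A}).
Local Notation H := (galg K G).
Local Notation V := (bdV D).
Local Notation F := (dual K (bdV D)).
Local Notation gr x := (jH i (ggen K x)).

Hypothesis bij : bijective (mult_VHF i).
Hypothesis deltaM : monoid_morphism delta.
Hypothesis deltaH : forall h, delta (jH i h) = tmap (jH i) (jH i) (gdelta h).

Lemma jF_word_gr t x : \prod_(f <- t) jF i f * gr x =
  gr x * \prod_(f <- [seq ract f (ggen K x) | f <- t]) jF i f.
Proof.
elim: t => [|f t ih]; first by rewrite !big_nil mul1r mulr1.
by rewrite !big_cons -mulrA ih mulrA rel_fg -mulrA.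
Qed.

Lemma pbw_word_gr s g t x : pbw_word i s (ggen K g) t * gr x =
  pbw_word i s (ggen K (g * x)%g) [seq ract f (ggen K x) | f <- t].
Proof. by rewrite /pbw_word -mulrA jF_word_gr ggenM rmorphM !mulrA. Qed.

(** On T(V) ⊗ H ⊗ T(V^* ) this is the tensor product of [word0], the indicator
function of S and [word0]. Invariance of S under x passes to it, because moving
x to the left across a word in V^* changes only the letters of this word. *)
Lemma indicator_functional (S : {pred G}) : exists q : {linear A -> K^o},
  [/\ forall v y, q (jV i v * y) = 0, forall f y, q (y * jF i f) = 0,
      forall g, q (gr g) = (g \in S)%:R
    & forall x, (forall g, (g * x)%g \in S = (g \in S)) ->
        forall y, q (y * gr x) = q y].
Proof.
have [q qE] := pbw_functional bij (gcoef K S) (@word0_multilinear _ V)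
  (@word0_multilinear _ F).
exists q; split.
- move=> v; apply: (pbw_ind bij) => [s g t|c a b ha hb|].
  + have -> : jV i v * pbw_word i s (ggen K g) t
        = pbw_word i (v :: s) (ggen K g) t.
      by rewrite /pbw_word big_cons !mulrA.
    by rewrite qE /= !mul0r.
  + by rewrite mulrDr -scalerAr linearP ha hb scaler0 addr0.
  + by rewrite mulr0 linear0.
- move=> f; apply: (pbw_ind bij) => [s g t|c a b ha hb|].
  + have -> : pbw_word i s (ggen K g) t * jF i f
        = pbw_word i s (ggen K g) (rcons t f).
      by rewrite /pbw_word big_rcons /= !mulrA.
    by rewrite qE; case: t => [|f' t] /=; rewrite mulr0.
  + by rewrite mulrDl -scalerAl linearP ha hb scaler0 addr0.
  + by rewrite mul0r linear0.
- move=> g; have := qE [::] (ggen K g) [::].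
  by rewrite /pbw_word !big_nil mul1r !mulr1 gcoefE mul1r.
- move=> x xS; apply: (pbw_ind bij) => [s g t|c a b ha hb|].
  + by rewrite pbw_word_gr !qE !gcoefE xS; case: t.
  + by rewrite mulrDl -scalerAl !linearP ha hb.
  + by rewrite mul0r.
Qed.

Variables (n : nat) (X Y : 'I_n -> A) (k l : 'I_n -> G).
(* X and Y stand for the skew-primitive generators of V and V^*, up to G. *)
Hypothesis deltaX : forall r, delta (X r) = X r ⊗ gr (k r) + 1 ⊗ X r.
Hypothesis deltaY : forall r, delta (Y r) = Y r ⊗ 1 + gr (l r) ⊗ Y r.
Hypothesis conjX : forall x r, exists c s, gr x * X r = c *: X s * gr x.
Hypothesis conjY : forall x r, exists c s, Y r * gr x = gr x * (c *: Y s).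
Hypothesis spanX : forall v, exists (c : 'I_n -> K) (a : 'I_n -> G),
  jV i v = \sum_r c r *: (X r * gr (a r)).
Hypothesis spanY : forall f, exists (c : 'I_n -> K) (a : 'I_n -> G),
  jF i f = \sum_r c r *: (Y r * gr (a r)).

(** The span of the products X_I g Y_J with g in P. *)
Inductive block (P : G -> Prop) : A -> Prop :=
| block_gr g : P g -> block P (gr g)
| block0 : block P 0
| block_lin c a b : block P a -> block P b -> block P (c *: a + b)
| blockX r a : block P a -> block P (X r * a)
| blockY r a : block P a -> block P (a * Y r).

Lemma blockZ P c a : block P a -> block P (c *: a).
Proof. by move=> h; rewrite -[_ *: _]addr0; apply: block_lin h (block0 P). Qed.

Lemma block_sum P I (s : seq I) (f : I -> A) :
  (forall x, block P (f x)) -> block P (\sum_(x <- s) f x).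
Proof.
move=> h; elim/big_rec: _ => [|x y _ hy]; first exact: block0.
by rewrite -[f x]scale1r; apply: block_lin.
Qed.

Lemma block_mul_grl P Q x a : (forall g, P g -> Q (x * g)%g) ->
  block P a -> block Q (gr x * a).
Proof.
move=> PQ; elim=> [g Pg||c {}a b _ ha _ hb|r {}a _ ha|r {}a _ ha].
- by rewrite -grM; apply: block_gr; apply: PQ.
- by rewrite mulr0; apply: block0.
- by rewrite mulrDr -scalerAr; apply: block_lin.
- have [c [s e]] := conjX x r; rewrite mulrA e -mulrA -scalerAl.
  by apply/blockZ/blockX.
- by rewrite mulrA; apply: blockY.
Qed.

Lemma block_mul_grr P Q x a : (forall g, P g -> Q (g * x)%g) ->
  block P a -> block Q (a * gr x).
Proof.
move=> PQ; elim=> [g Pg||c {}a b _ ha _ hb|r {}a _ ha|r {}a _ ha].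
- by rewrite -grM; apply: block_gr; apply: PQ.
- by rewrite mul0r; apply: block0.
- by rewrite mulrDl -scalerAl; apply: block_lin.
- by rewrite -mulrA; apply: blockX.
- have [c [s e]] := conjY x r; rewrite -mulrA e mulrA -scalerAr.
  by apply/blockZ/blockY.
Qed.

Lemma block_total a : block (fun=> True) a.
Proof.
apply: (pbw_ind bij) a => [s g t|c a b|]; [|exact: block_lin|exact: block0].
have mulV v a : block (fun=> True) a -> block (fun=> True) (jV i v * a).
  move=> ha; have [c [x ->]] := spanX v; rewrite mulr_suml.
  apply: block_sum => r; rewrite -scalerAl -mulrA.
  by apply/blockZ/blockX/(block_mul_grl _ ha).
have mulF f a : block (fun=> True) a -> block (fun=> True) (a * jF i f).
  move=> ha; have [c [x ->]] := spanY f; rewrite mulr_sumr.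
  apply: block_sum => r; rewrite -scalerAr mulrA.
  by apply/blockZ/(block_mul_grr (P := fun=> True)) => //; apply: blockY.
rewrite /pbw_word; elim/last_ind: t => [|t f ih].
  rewrite big_nil mulr1; elim: s => [|v s ih].
    by rewrite big_nil mul1r; apply: block_gr.
  by rewrite big_cons -mulrA; apply: mulV.
by rewrite big_rcons /= mulrA; apply: mulF.
Qed.

Lemma block_split P a : exists c d,
  [/\ block P c, block (fun g => ~ P g) d & a = c + d].
Proof.
elim: (block_total a) => [g _||k0 _ _ _ [c [d [hc hd ->]]] _ [c' [d' [hc' hd' ->]]]
    |r _ _ [c [d [hc hd ->]]]|r _ _ [c [d [hc hd ->]]]].
- have [Pg|Pg] := boolp.EM (P g).
    by exists (gr g), 0; rewrite addr0; split; [apply: block_gr|apply: block0|].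
  by exists 0, (gr g); rewrite add0r; split; [apply: block0|apply: block_gr|].
- by exists 0, 0; rewrite addr0; split=> //; apply: block0.
- exists (k0 *: c + c'), (k0 *: d + d'); rewrite scalerDr addrACA.
  by split=> //; apply: block_lin.
- by exists (X r * c), (X r * d); rewrite mulrDr; split=> //; apply: blockX.
- by exists (c * Y r), (d * Y r); rewrite mulrDl; split=> //; apply: blockY.
Qed.

Lemma block_subcoalgebra P :
  (forall r g, P g -> P (k r * g)%g) -> (forall r g, P g -> P (g * l r)%g) ->
  subcoalgebra delta (block P).
Proof.
move=> Pk Pl; have BL := @block_lin P; have B0 := block0 P.
split; [exact: block0|exact: block_lin|move=> a].
elim=> [g Pg||c {}a b _ ha _ hb|r {}a _ ha|r {}a _ ha].
- by rewrite delta_gr //; apply: tens_sub_pure; apply: block_gr.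
- by rewrite linear0; apply: tens_sub0.
- by rewrite linearP; apply: (tens_sub_lin BL B0).
- rewrite deltaM.2 deltaX mulrDl; apply: (tens_subD BL B0).
  + apply: (tens_sub_mull BL B0) => // y; first exact: blockX.
    exact: block_mul_grl (Pk r).
  + apply: (tens_sub_mull BL B0) => // y; first by rewrite mul1r.
    exact: blockX.
- rewrite deltaM.2 deltaY mulrDr; apply: (tens_subD BL B0).
  + apply: (tens_sub_mulr BL B0) => // y; first exact: blockY.
    by rewrite mulr1.
  + apply: (tens_sub_mulr BL B0) => // y; last exact: blockY.
    exact: block_mul_grr (Pl r).
Qed.

(** Let E(a) = q(a_1) a_2. As q kills X_r A and A Y_r and is invariant under
right multiplication by l_r, the coproducts of the generators give
E(X_r a) = X_r E(a) and E(a Y_r) = E(a) Y_r, while E(g) = q(g) g. *)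
Lemma block_eigen (q : {linear A -> K^o}) P (b : K) a :
  (forall r y, q (X r * y) = 0) -> (forall r y, q (y * Y r) = 0) ->
  (forall r y, q (y * gr (l r)) = q y) -> (forall g, P g -> q (gr g) = b) ->
  block P a -> contract q idfun (delta a) = b *: a.
Proof.
move=> qX qY ql qg.
elim=> [g Pg||c {}a a' _ ha _ ha'|r {}a _ ha|r {}a _ ha].
- by rewrite delta_gr // contractE qg.
- by rewrite !linear0.
- by rewrite linearP linearP /= ha ha' scalerDr !scalerA mulrC.
- rewrite deltaM.2 deltaX mulrDl linearD /=.
  have -> z : contract q idfun ((X r ⊗ gr (k r)) * z) = 0.
    elim/tens_ind: z => [u v|c x y hx hy|].
    + by rewrite tens_mulE contractE qX scale0r.
    + by rewrite mulrDr tens_scaleAr linearP /= hx hy scaler0 addr0.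
    + by rewrite mulr0 linear0.
  have -> z : contract q idfun ((1 ⊗ X r) * z) = X r * contract q idfun z.
    elim/tens_ind: z => [u v|c x y hx hy|].
    + by rewrite tens_mulE !contractE mul1r /= scalerAr.
    + by rewrite mulrDr tens_scaleAr !linearP /= hx hy mulrDr scalerAr.
    + by rewrite mulr0 !linear0 mulr0.
  by rewrite add0r ha scalerAr.
- rewrite deltaM.2 deltaY mulrDr linearD /=.
  have -> z : contract q idfun (z * (Y r ⊗ 1)) = 0.
    elim/tens_ind: z => [u v|c x y hx hy|].
    + by rewrite tens_mulE contractE qY scale0r.
    + by rewrite mulrDl tens_scaleAl linearP /= hx hy scaler0 addr0.
    + by rewrite mul0r linear0.
  have -> z : contract q idfun (z * (gr (l r) ⊗ Y r)) = contract q idfun z * Y r.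
    elim/tens_ind: z => [u v|c x y hx hy|].
    + by rewrite tens_mulE !contractE ql /= scalerAl.
    + by rewrite mulrDl tens_scaleAl !linearP /= hx hy mulrDl scalerAl.
    + by rewrite mul0r !linear0 mul0r.
  by rewrite add0r ha scalerAl.
Qed.

(** The two subcoalgebras are the blocks of S and of its complement. The latter
is stable under the left multiplications by k_r and the right ones by l_r since
these elements belong to S, which is a group. *)
Lemma indecomposable_generates :
  (forall S : {pred G}, exists q : {linear A -> K^o},
    [/\ forall r y, q (X r * y) = 0, forall r y, q (y * Y r) = 0,
      forall g, q (gr g) = (g \in S)%:R
    & forall x, (forall g, (g * x)%g \in S = (g \in S)) ->
        forall y, q (y * gr x) = q y]) ->
  indecomposable delta -> generates (fun g => exists r, g = k r \/ g = l r).
Proof.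
move=> indicator indec S clS XS g.
have [S1 _] := clS.
have SM := group_closedM clS; have SV := group_closedV clS.
have kS r : k r \in S by apply: XS; exists r; left.
have lS r : l r \in S by apply: XS; exists r; right.
have SMl x y : x \in S -> (x * y \in S)%g = (y \in S).
  move=> xS; apply/idP/idP => [xyS|]; last exact: SM.
  by rewrite -(mulKg x y); apply: SM => //; apply: SV.
have SMr x y : x \in S -> (y * x \in S)%g = (y \in S).
  move=> xS; apply/idP/idP => [yxS|yS]; last exact: SM.
  by rewrite -(mulgK x y); apply: SM => //; apply: SV.
have [q [qX qY qg qx]] := indicator S.
have ql r y : q (y * gr (l r)) = q y by apply: qx => x; rewrite SMr.
have gr_neq0 x : gr x != 0.
  apply: contraTneq isT => gx0; have := grVK i x 1.
  by rewrite gx0 mul0r mulr0 => /eqP; rewrite eq_sym oner_eq0.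
have [||||C0|D0] := indec (block (fun x => x \in S)) (block (fun x => ~ x \in S)).
- apply: block_subcoalgebra => r x; first by rewrite (SMl _ _ (kS r)).
  by rewrite (SMr _ _ (lS r)).
- apply: block_subcoalgebra => r x; first by rewrite (SMl _ _ (kS r)).
  by rewrite (SMr _ _ (lS r)).
- exact: block_split.
- move=> a Ca Da.
  have Ea : contract q idfun (delta a) = 1 *: a.
    by apply: (block_eigen qX qY ql _ Ca) => x xS; rewrite qg xS.
  have := block_eigen (b := 0) qX qY ql _ Da.
  rewrite Ea scale0r scale1r; apply=> x /negP/negPf xS.
  by rewrite qg xS.
- by have := C0 _ (block_gr S1); move/eqP; rewrite (negPf (gr_neq0 _)).
- case: (boolP (g \in S)) => // /negP gS.
  by have := D0 _ (block_gr gS); move/eqP; rewrite (negPf (gr_neq0 _)).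
Qed.

End Blocks.

(** * The cross relation *)

Section Degrees.
Variables (K : fieldType) (G : groupType) (D : braided_datum K G).
Variables (A : algType K) (i : double_map D A).
Local Notation H := (galg K G).
Local Notation V := (bdV D).
Local Notation F := (dual K (bdV D)).
Local Notation gr x := (jH i (ggen K x)).

Lemma distinct_degreesE (W : vectType K) (deg : W -> G -> Prop) m :
  \dim {:W} = m -> distinct_degrees deg ->
  exists (e : m.-tuple W) (d : 'I_m -> G),
    [/\ basis_of {:W} e, injective d & forall r, deg (tnth e r) (d r)].
Proof. by move=> <- [e [d [be he inj_d]]]; exists e, d. Qed.

Lemma dim_dual : \dim {:F} = \dim {:V}.
Proof. by rewrite !dimvf /dim /= muln1. Qed.

Lemma ractM (f : F) x y :
  ract (ract f (ggen K x)) (ggen K y) = ract f (ggen K (x * y)%g).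
Proof.
have [_ _ actM] := bdactP D.
by apply/lfunP => v; rewrite !ractE ggenM actM.
Qed.

Lemma ract1 (f : F) : ract f (ggen K 1%g) = f.
Proof.
have [_ act1 _] := bdactP D.
by apply/lfunP => v; rewrite ractE -[ggen K 1%g]/(1 : H) act1.
Qed.

Lemma act1 (v : V) : bdact (ggen K 1%g) v = v.
Proof. by have [_ a1 _] := bdactP D; exact: a1. Qed.

Lemma actM (v : V) x y :
  bdact (ggen K (x * y)%g) v = bdact (ggen K x) (bdact (ggen K y) v).
Proof. by have [_ _ aM] := bdactP D; rewrite ggenM aM. Qed.

Lemma actZ c (v : V) x : bdact (ggen K x) (c *: v) = c *: bdact (ggen K x) v.
Proof.
have [bi _ _] := bdactP D.
pose aM := GRing.isLinear.Build K V V _ _ (bi.2 (ggen K x)).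
pose aL : {linear V -> V} := HB.pack (bdact (ggen K x)) aM.
by have := linearZ_LR aL c v.
Qed.

Lemma ractZ c (f : F) h : ract (c *: f) h = c *: ract f h.
Proof. by apply/lfunP => v; rewrite ractE !scale_lfunE ractE. Qed.

Lemma rel_gf f x : gr x * jF i f = jF i (ract f (ggen K x^-1%g)) * gr x.
Proof. by rewrite rel_fg ractM mulVg ract1. Qed.

Hypothesis bij : bijective (mult_VHF i).

Lemma V_functional (phi : {linear V -> K^o}) :
  exists L : {linear A -> K^o},
    [/\ forall v x, L (jV i v * gr x) = phi v,
        forall x f, L (gr x * jF i f) = 0 & forall h, L (jH i h) = 0].
Proof.
have [L LE] := pbw_functional bij (gcoef K predT) (word1_multilinear phi)
  (@word0_multilinear _ F).
exists L; split=> [v x|x f|h].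
- have := LE [:: v] (ggen K x) [::].
  by rewrite /pbw_word big_seq1 big_nil mulr1 gcoefE !mulr1.
- have := LE [::] (ggen K x) [:: f].
  by rewrite /pbw_word big_seq1 big_nil mul1r /= mul0r mulr0.
- have := LE [::] h [::].
  by rewrite /pbw_word !big_nil mul1r mulr1 /= !mul0r.
Qed.

Lemma F_functional (psi : {linear F -> K^o}) :
  exists L : {linear A -> K^o},
    [/\ forall x f, L (gr x * jF i f) = psi f,
        forall v x, L (jV i v * gr x) = 0 & forall h, L (jH i h) = 0].
Proof.
have [L LE] := pbw_functional bij (gcoef K predT) (@word0_multilinear _ V)
  (word1_multilinear psi).
exists L; split=> [x f|v x|h].
- have := LE [::] (ggen K x) [:: f].
  by rewrite /pbw_word big_seq1 big_nil mul1r gcoefE !mul1r.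
- have := LE [:: v] (ggen K x) [::].
  by rewrite /pbw_word big_seq1 big_nil mulr1 /= !mul0r.
- have := LE [::] h [::].
  by rewrite /pbw_word !big_nil mul1r mulr1 /= mulr0.
Qed.

Lemma H_functional (beta : {linear H -> K^o}) :
  exists L : {linear A -> K^o},
    [/\ forall h, L (jH i h) = beta h, forall v, L (jV i v) = 0
      & forall f, L (jF i f) = 0].
Proof.
have [L LE] := pbw_functional bij beta (@word0_multilinear _ V)
  (@word0_multilinear _ F).
exists L; split=> [h|v|f].
- have := LE [::] h [::].
  by rewrite /pbw_word !big_nil mul1r !mulr1 mul1r.
- have := LE [:: v] (ggen K 1%g) [::].
  by rewrite /pbw_word big_seq1 big_nil gr1 !mulr1 /= mul0r.
- have := LE [::] (ggen K 1%g) [:: f].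
  by rewrite /pbw_word big_seq1 big_nil gr1 !mul1r /= mulr0.
Qed.

Lemma separated_V : separated i (jV i).
Proof.
split=> [phi|beta].
  have [L [LV _ LH]] := V_functional phi; exists L; split=> // v.
  by rewrite -(LV v 1%g) gr1 mulr1.
by have [L [LH LV _]] := H_functional beta; exists L.
Qed.

Lemma separated_F : separated i (jF i).
Proof.
split=> [psi|beta].
  have [L [LF _ LH]] := F_functional psi; exists L; split=> // f.
  by rewrite -(LF 1%g f) gr1 mul1r.
by have [L [LH _ LF]] := H_functional beta; exists L.
Qed.

Variables (delta : {linear A -> tens A A}).
Hypothesis deltaM : monoid_morphism delta.
Hypothesis deltaH : forall h, delta (jH i h) = tmap (jH i) (jH i) (gdelta h).

(** Apply psi ⊗ phi and phi ⊗ psi, extended by 0 to the other components of the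
triangular decomposition, to the coproduct of f v - v f = beta(f, v). The
right-hand side, in H ⊗ H, is killed; on the left only the two terms with f and
v on the chosen sides survive, once they are brought into the order v h f. *)
Lemma cross_degrees v f d h d' h' (phi : {linear V -> K^o})
    (psi : {linear F -> K^o}) :
  bihomogeneous i delta (jV i) v d h -> bihomogeneous i delta (jF i) f d' h' ->
  psi (ract f (ggen K h)) *: phi (bdact (ggen K d') v) = psi f *: phi v /\
  phi (bdact (ggen K h') v) *: psi (ract f (ggen K d)) = phi v *: psi f.
Proof.
move=> hv hf.
have [L [LV LF LH]] := V_functional phi.
have [M [MF MV MH]] := F_functional psi.
have := congr1 delta (rel_FV i f v).
rewrite linearB /= !deltaM.2 hv hf deltaH !mulrDl !mulrDr !tens_mulE => E.
split.
- have := congr1 (contract M L) E.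
  rewrite contract_tmap linearB !linearD /= !contractE -!grM.
  rewrite !rel_gv !rel_fg !MH !LH !MV !MF !LV !scale0r !scaler0.
  rewrite !(oppr0, addr0, add0r).
  rewrite (_ : contract _ _ _ = 0); first by move/eqP; rewrite subr_eq0 => /eqP.
  have [s ->] := tens_span (gdelta (bdbeta D (f ⊗ v))).
  by rewrite linear_sum big1 // => p _; rewrite /= contractE /= MH scale0r.
- have := congr1 (contract L M) E.
  rewrite contract_tmap linearB !linearD /= !contractE -!grM.
  rewrite !rel_gv !rel_fg !MH !LH !LF !MF !LV !scale0r !scaler0.
  rewrite !(oppr0, addr0, add0r).
  rewrite (_ : contract _ _ _ = 0); first by move/eqP; rewrite subr_eq0 => /eqP.
  have [s ->] := tens_span (gdelta (bdbeta D (f ⊗ v))).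
  by rewrite linear_sum big1 // => p _; rewrite /= contractE /= LH scale0r.
Qed.

End Degrees.

(** * Characters and the theorem *)

Section Characters.
Variables (K : fieldType) (G : groupType) (D : braided_datum K G).
Local Notation V := (bdV D).
Local Notation F := (dual K (bdV D)).

Lemma act_div (v : V) x y a b : b != 0 ->
  bdact (ggen K x) v = a *: v -> bdact (ggen K y) v = b *: v ->
  bdact (ggen K (x * y^-1)%g) v = (a / b) *: v.
Proof.
move=> b0 xv yv.
have yVv : bdact (ggen K y^-1%g) v = b^-1 *: v.
  rewrite -{1}[v]scale1r -(mulVf b0) -scalerA -yv actZ -actM mulVg.
  by rewrite act1.
by rewrite actM yVv actZ xv scalerA mulrC.
Qed.

Lemma ract_div (f : F) x y a b : b != 0 ->
  ract f (ggen K x) = a *: f -> ract f (ggen K y) = b *: f ->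
  ract f (ggen K (x * y^-1)%g) = (a / b) *: f.
Proof.
move=> b0 xf yf.
have yVf : ract f (ggen K y^-1%g) = b^-1 *: f.
  rewrite -{1}[f]scale1r -(mulVf b0) -scalerA -yf ractZ ractM mulgV.
  by rewrite ract1.
by rewrite -ractM xf ractZ yVf scalerA.
Qed.

End Characters.

Lemma coord_scale_tnth (K : fieldType) (W : vectType K) m (e : m.-tuple W)
    (c : K) s r : basis_of {:W} e ->
  coord e r (c *: tnth e s) = c * (s == r)%:R :> K.
Proof. by move=> be; rewrite linearZ /= coord_tnth. Qed.

Lemma scale_basis_coord (K : fieldType) (W : vectType K) m (e : m.-tuple W)
    x r (q : K * 'I_m) : basis_of {:W} e -> x = q.1 *: tnth e q.2 ->
  coord e r x != 0 -> x = coord e r x *: tnth e r.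
Proof.
move=> be ->; rewrite coord_scale_tnth //.
by case: (q.2 =P r) => [->|_]; rewrite ?mulr1 // mulr0 eqxx.
Qed.

Lemma scale_basis_inj (K : fieldType) (W : vectType K) m (e : m.-tuple W)
    (b c : K) r s : basis_of {:W} e -> c != 0 ->
  b *: tnth e s = c *: tnth e r -> b = c.
Proof.
move=> be c0 /(congr1 (coord e r)); rewrite !coord_scale_tnth // eqxx mulr1.
case: (s == r); first by rewrite mulr1.
by rewrite mulr0 => c1; rewrite -c1 eqxx in c0.
Qed.

(* The generators of V are read up to grouplike elements: w is a basis of V and
   v_r = w_r a_r with a_r in G, and likewise f_r = u_r b_r for V^*. A generator
   in V itself would need left degree 1, and a_r, b_r absorb that shift. *)
Theorem proposition6 (K : fieldType) (G : groupType) (D : braided_datum K G)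
    (A : algType K) (i : double_map D A)
    (delta : {linear A -> tens A A}) (eps : {linear A -> K^o})
    (n : nat) (dimV : \dim {:bdV D} = n)
    (hopfA : triangular_hopf i delta eps)
    (wsepA : weakly_separable i delta)
    (indecA : indecomposable delta) :
  exists (k l : 'I_n -> G)
         (w : n.-tuple (bdV D)) (a : 'I_n -> G)
         (u : n.-tuple (dual K (bdV D))) (b : 'I_n -> G),
    let v r := jV i (tnth w r) * jH i (ggen K (a r)) in
    let f r := jF i (tnth u r) * jH i (ggen K (b r)) in
    [/\ basis_of {:bdV D} w /\ basis_of {:dual K (bdV D)} u,
        generates (fun g => exists r, g = k r \/ g = l r),
        (forall r, delta (v r) = v r ⊗ jH i (ggen K (k r)) + 1 ⊗ v r) /\
        (forall r, delta (f r) = f r ⊗ 1 + jH i (ggen K (l r)) ⊗ f r),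
        forall r s, (k r * l s = l s * k r)%g
      & exists (lambda mu : 'I_n -> G -> K) (sigma tau : G -> 'I_n -> 'I_n),
          [/\ left_characters w lambda sigma, right_characters u mu tau
            & forall r s, mu s (k r) = (lambda r (l s))^-1]].
Proof.
have [[[_ bij] [[coalg deltaM _] [deltaH _ _ _ _]]] _] := hopfA.
have [degV _ degF _] := wsepA.
have sepV := separated_V bij; have sepF := separated_F bij.
have [w [d [bw inj_d deg_w]]] := distinct_degreesE dimV degV.
have [u [d' [bu inj_d' deg_u]]] :=
  distinct_degreesE (etrans (dim_dual D) dimV) degF.
have /boolp.choice[h hw] :=
  right_degree_bihomogeneous coalg deltaH sepV bw inj_d deg_w.
have /boolp.choice[h' hu] :=
  right_degree_bihomogeneous coalg deltaH sepF bu inj_d' deg_u.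
have stableV x v : exists v', jH i (ggen K x) * jV i v = jV i v' * jH i (ggen K x).
  by exists (bdact (ggen K x) v); apply: rel_gv.
have stableF x f : exists f', jH i (ggen K x) * jF i f = jF i f' * jH i (ggen K x).
  by exists (ract f (ggen K x^-1%g)); apply: rel_gf.
have conjV := bihomogeneous_basis_conj deltaH sepV deltaM bw inj_d hw.
have conjF := bihomogeneous_basis_conj deltaH sepF deltaM bu inj_d' hu.
pose k r := (d r * (h r)^-1)%g; pose l r := (h' r * (d' r)^-1)%g.
pose a r := ((h r)^-1)%g; pose b r := ((d' r)^-1)%g.
pose v r := jV i (tnth w r) * jH i (ggen K (a r)).
pose f r := jF i (tnth u r) * jH i (ggen K (b r)).
have /boolp.choice[lam lamE] (p : G * 'I_n) : exists q : K * 'I_n,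
    bdact (ggen K p.1) (tnth w p.2) = q.1 *: tnth w q.2.
  have [c [s [E _]]] := conjV p.1 p.2 _ (rel_gv i p.1 (tnth w p.2)).
  by exists (c, s).
have /boolp.choice[mu muE] (p : G * 'I_n) : exists q : K * 'I_n,
    ract (tnth u p.2) (ggen K p.1) = q.1 *: tnth u q.2.
  have := rel_gf i (tnth u p.2) p.1^-1%g; rewrite invgK => /conjF[c [s [E _]]].
  by exists (c, s).
have coordw r : coord w r (tnth w r) = 1 by rewrite coord_tnth // eqxx.
have coordu s : coord u s (tnth u s) = 1 by rewrite coord_tnth // eqxx.
have eigen x y r s :
    coord u s (ract (tnth u s) (ggen K x))
      * coord w r (bdact (ggen K y) (tnth w r)) = 1 ->
    exists m p, [/\ ract (tnth u s) (ggen K x) = m *: tnth u s,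
      bdact (ggen K y) (tnth w r) = p *: tnth w r & m * p = 1].
  move=> mp1; have : coord u s (ract (tnth u s) (ggen K x))
      * coord w r (bdact (ggen K y) (tnth w r)) != 0 by rewrite mp1 oner_eq0.
  rewrite mulf_eq0 negb_or => /andP[m0 p0].
  exists (coord u s (ract (tnth u s) (ggen K x))).
  exists (coord w r (bdact (ggen K y) (tnth w r))); split=> //.
    exact: scale_basis_coord bu (muE (x, s)) m0.
  exact: scale_basis_coord bw (lamE (y, r)) p0.
(* m p = 1 is the component f ⊗ v, and m' p' = 1 the component v ⊗ f *)
have cross r s : exists m p m' p',
    [/\ ract (tnth u s) (ggen K (h r)) = m *: tnth u s,
        bdact (ggen K (d' s)) (tnth w r) = p *: tnth w r & m * p = 1] /\
    [/\ ract (tnth u s) (ggen K (d r)) = m' *: tnth u s,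
        bdact (ggen K (h' s)) (tnth w r) = p' *: tnth w r & m' * p' = 1].
  have [E1 E2] := cross_degrees bij deltaM deltaH (coord w r) (coord u s)
    (hw r) (hu s).
  move: E1 E2; rewrite /= !regular_scaleE coordw coordu mulr1 => E1.
  rewrite mulrC => E2.
  have [m [p mp]] := eigen _ _ _ _ E1.
  by have [m' [p' mp']] := eigen _ _ _ _ E2; exists m, p, m', p'.
have neq0l (x y : K) : x * y = 1 -> x != 0.
  by move=> xy; apply: contraTneq isT => x0; move: xy;
     rewrite x0 mul0r => /eqP; rewrite eq_sym oner_eq0.
have neq0r (x y : K) : x * y = 1 -> y != 0 by rewrite mulrC; apply: neq0l.
exists k, l, w, a, u, b => /=; split.
- by [].
- apply: (@indecomposable_generates _ _ _ _ i delta bij deltaM deltaH _ v f).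
  + by move=> r; rewrite /v (delta_shifted deltaH deltaM _ (hw r)) mulgV gr1.
  + by move=> r; rewrite /f (delta_shifted deltaH deltaM _ (hu r)) mulgV gr1.
  + apply: (shifted_basis_conj deltaH sepV deltaM stableV bw inj_d hw).
    by move=> r s x _ hs; rewrite /a hs !invgM invgK mulgA.
  + move=> x s; have [|c [t E]] :=
      shifted_basis_conj (a := b) deltaH sepF deltaM stableF bu inj_d' hu _ x^-1%g s.
      by move=> r t y ds _; rewrite /b ds !invgM invgK mulgA.
    exists c, t; rewrite -[LHS](grKV i x) [X in _ * X]mulrA E.
    by rewrite -mulrA -grM mulVg gr1 mulr1.
  + by move=> z; apply: shifted_span.
  + by move=> z; apply: shifted_span.
  + move=> S; have [q [qV qF qg qx]] := indicator_functional bij S.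
    exists q; split=> // r y; first by rewrite /v -mulrA qV.
    by rewrite /f rel_fg mulrA qF.
  + exact: indecA.
- split=> r.
  + by rewrite (delta_shifted deltaH deltaM _ (hw r)) mulgV gr1.
  + by rewrite (delta_shifted deltaH deltaM _ (hu r)) mulgV gr1.
- move=> r s; have [m [p [m' [p' [[_ p_d' /neq0r p0] [_ p_h' /neq0r p0']]]]]] :=
    cross r s.
  have [dd' hd'] : commute (d' s) (d r) /\ commute (d' s) (h r).
    apply: (eigenvector_commute deltaH sepV deltaM bw hw p0).
    by rewrite rel_gv p_d'.
  have [dh' hh'] : commute (h' s) (d r) /\ commute (h' s) (h r).
    apply: (eigenvector_commute deltaH sepV deltaM bw hw p0').
    by rewrite rel_gv p_h'.
  have kd' : commute (k r) (d' s).
    by apply/commute_sym/commuteM => //; apply/commuteV.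
  have kh' : commute (k r) (h' s).
    by apply/commute_sym/commuteM => //; apply/commuteV.
  by apply: commuteM => //; apply/commuteV.
exists (fun r g => (lam (g, r)).1), (fun s g => (mu (g, s)).1).
exists (fun g r => (lam (g, r)).2), (fun g s => (mu (g, s)).2).
split=> [g r|g s|r s]; [exact: lamE (g, r)|exact: muE (g, s)|].
have [m [p [m' [p' [[m_h p_d' mp] [m_d p_h' mp']]]]]] := cross r s.
have mk := ract_div (neq0l _ _ mp) m_d m_h.
have pl := act_div (neq0r _ _ mp) p_h' p_d'.
rewrite (muE (_, _)) in mk; rewrite (lamE (_, _)) in pl.
have m0 := neq0l _ _ mp; have m'0 := neq0l _ _ mp'.
have p0 := neq0r _ _ mp; have p'0 := neq0r _ _ mp'.
have div0 (x y : K) : x != 0 -> y != 0 -> x / y != 0.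
  by move=> x0 y0; rewrite mulf_neq0 ?invr_eq0.
have -> := scale_basis_inj bu (div0 _ _ m'0 m0) mk.
have -> := scale_basis_inj bw (div0 _ _ p'0 p0) pl.
rewrite invf_div; apply: (mulfI m0); apply: (mulIf p'0).
by rewrite mulrCA mulfV // mulr1 mp' mulrA mp div1r mulVf.
Qed.
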